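(* For each $\varepsilon\in(0,1)$ there is a constant $C(\varepsilon)>0$, depending only on $\varepsilon$, such that for every semi-infinite Jacobi matrix $J=J(\{a_j\},\{b_j\},\{c_j\})_{j\in\mathbb N}$ with $J-J_0\in\mathcal S_1$ one has $$\sum_{\lambda\in\sigma_d(J)}\frac{\operatorname{dist}(\lambda,[-2,2])}{|\lambda^2-4|^{\frac{1-\varepsilon}{2}}}\le C(\varepsilon)\,\Delta,\qquad \Delta:=\sum_{n=1}^\infty\bigl(|b_n|+|1-a_nc_n|\bigr),$$ where each eigenvalue in the sum is repeated according to its algebraic multiplicity.
   Context: $\mathbb N=\{1,2,\dots\}$. $J=J(\{a_j\},\{b_j\},\{c_j\})_{j\in\mathbb N}$ is the operator on $\ell^2(\mathbb N)$ given by the semi-infinite tridiagonal matrix with diagonal entries $J_{k,k}=b_k$, superdiagonal entries $J_{k,k+1}=c_k$ and subdiagonal entries $J_{k+1,k}=a_k$, $k\ge1$, where $a_k,b_k,c_k$ are uniformly bounded complex numbers and $a_kc_k\ne0$ for all $k\in\mathbb N$. $J_0=J(\{1\},\{0\},\{1\})$ is the discrete Laplacian on the half-line, with spectrum $[-2,2]$. $\mathcal S_1$ is the trace class; $J-J_0\in\mathcal S_1$ is equivalent to $\sum_{n\ge1}(|1-a_n|+|b_n|+|1-c_n|)<\infty$. The discrete spectrum $\sigma_d(J)$ is the set of isolated eigenvalues of $J$ of finite algebraic multiplicity; when $J-J_0$ is compact, $\sigma(J)=[-2,2]\cup\sigma_d(J)$ with $\sigma_d(J)\subset\mathbb C\setminus[-2,2]$.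 *)

(* Defs.v *)
From HB Require Import structures.
From mathcomp Require Import all_boot all_order all_algebra.
From mathcomp Require Import all_classical all_reals all_analysis.
From mathcomp Require Import ring complex.

Set Implicit Arguments.
Unset Strict Implicit.
Unset Printing Implicit Defensive.

Import Order.TTheory GRing.Theory Num.Theory.
Import numFieldNormedType.Exports.
Import ComplexField.Normc.

Local Open Scope classical_set_scope.
Local Open Scope ring_scope.
Local Open Scope complex_scope.

Section SquareSummable.
Context {R : realType}.
Implicit Types x y : nat -> R[i].

Definition sqsum x : \bar R := \sum_(0 <= n <oo) (normc (x n) ^+ 2)%:E.

Definition square_summable : {pred nat -> R[i]} :=
  fun x => `[< (sqsum x < +oo)%E >].

Lemma square_summableP x : reflect (sqsum x < +oo)%E (x \in square_summable).
Proof. exact: asboolP. Qed.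

Lemma normc_ge0 (z : R[i]) : 0 <= normc z.
Proof. by case: z => a b /=; rewrite sqrtr_ge0. Qed.

Lemma normcD_sqr (z w : R[i]) :
  normc (z + w) ^+ 2 <= 2 * normc z ^+ 2 + 2 * normc w ^+ 2.
Proof.
have /le_trans : normc (z + w) ^+ 2 <= (normc z + normc w) ^+ 2.
  by rewrite lerXn2r ?nnegrE ?addr_ge0 ?normc_ge0 ?le_normcD.
apply; rewrite -subr_ge0.
have -> : 2 * normc z ^+ 2 + 2 * normc w ^+ 2 - (normc z + normc w) ^+ 2
          = (normc z - normc w) ^+ 2.
  rewrite sqrrD sqrrB !mulr_natl !mulr2n; set p := normc z; set q := normc w.
  by rewrite -!mulr2n; set u := p ^+ 2; set v := q ^+ 2; ring.
exact: sqr_ge0.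
Qed.

Lemma sqsum_dom x y (K : R) : 0 <= K ->
  (forall n, normc (x n) ^+ 2 <= K * normc (y n) ^+ 2) ->
  y \in square_summable -> x \in square_summable.
Proof.
move=> K0 xy /square_summableP yfin; apply/square_summableP.
apply: (@le_lt_trans _ _ (K%:E * sqsum y)%E).
  rewrite /sqsum -nneseriesZl; last by move=> n _; rewrite lee_fin sqr_ge0.
  by apply: lee_nneseries => n _ *; rewrite ?lee_fin ?sqr_ge0 ?xy.
by rewrite lte_mul_pinfty.
Qed.

Lemma square_summable0 : 0 \in square_summable.
Proof.
apply/square_summableP; rewrite /sqsum eseries0 ?ltry// => n _ _.
rewrite (_ : (0 : nat -> R[i]) n = 0)//.
by rewrite (_ : normc (0 : R[i]) = 0) ?expr0n//; exact: normc0.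
Qed.

Lemma square_summableD x y :
  x \in square_summable -> y \in square_summable -> x + y \in square_summable.
Proof.
move=> /square_summableP xs /square_summableP ys; apply/square_summableP.
apply: (@le_lt_trans _ _ (2%:E * sqsum x + 2%:E * sqsum y)%E); last first.
  by rewrite lte_add_pinfty// lte_mul_pinfty.
rewrite /sqsum -!nneseriesZl; try by move=> n _; rewrite lee_fin sqr_ge0.
rewrite -nneseriesD; try by move=> n _ *; rewrite mule_ge0 ?lee_fin ?sqr_ge0.
apply: lee_nneseries => n _ *; rewrite ?lee_fin ?sqr_ge0//.
exact: normcD_sqr.
Qed.

Lemma square_summableM (a : nat -> R[i]) (M : R) x :
  (forall n, normc (a n) <= M) -> x \in square_summable ->
  (fun n => a n * x n) \in square_summable.
Proof.
move=> aM; apply: (@sqsum_dom _ _ (M ^+ 2)); first exact: sqr_ge0.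
move=> n; rewrite normcM exprMn ler_wpM2r ?sqr_ge0//.
by rewrite lerXn2r ?nnegrE ?normc_ge0//; exact: le_trans (normc_ge0 _) (aM n).
Qed.

Lemma square_summable_submod : submod_closed square_summable.
Proof.
split=> [|k x y xs ys]; first exact: square_summable0.
apply: square_summableD => //.
exact: (@square_summableM (fun=> k) (normc k)).
Qed.

HB.instance Definition _ :=
  GRing.isSubmodClosed.Build _ _ square_summable square_summable_submod.

Lemma square_summable_shiftl x :
  x \in square_summable -> (fun n => x n.+1) \in square_summable.
Proof.
move=> /square_summableP xs; apply/square_summableP; apply: le_lt_trans xs.
rewrite /sqsum [leRHS]nneseries_recl//; last by move=> n _; rewrite lee_fin sqr_ge0.
rewrite -[X in (_ <= _ + X)%E](nneseries_addn 1); last first.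
  by move=> n; rewrite lee_fin sqr_ge0.
under [X in (_ <= _ + X)%E]eq_eseriesr do rewrite addn1.
by rewrite leeDr// lee_fin sqr_ge0.
Qed.

Lemma square_summable_shiftr x : x \in square_summable ->
  (fun n => if n is m.+1 then x m else 0) \in square_summable.
Proof.
move=> /square_summableP xs; apply/square_summableP; apply: le_lt_trans xs.
rewrite /sqsum nneseries_recl//; last by move=> n _; rewrite lee_fin sqr_ge0.
rewrite -(nneseries_addn 1); last by move=> n; rewrite lee_fin sqr_ge0.
under eq_eseriesr do rewrite addn1.
rewrite (_ : normc (0 : R[i]) = 0); last exact: normc0.
by rewrite expr0n/= add0e.
Qed.

Lemma square_summable_delta k :
  (fun n => (n == k)%:R : R[i]) \in square_summable.
Proof.
elim: k => [|k].
  apply/square_summableP; rewrite /sqsum nneseries_recl//; last first.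
    by move=> n _; rewrite lee_fin sqr_ge0.
  rewrite -(nneseries_addn 1); last by move=> n; rewrite lee_fin sqr_ge0.
  rewrite eseries0 ?adde0 ?ltry// => n _ _.
  by rewrite addn1/= expr0n/= addr0 sqrtr0 expr0n.
move=> /square_summable_shiftr.
suff -> : (fun n => (n == k.+1)%:R) =
    (fun n => if n is m.+1 then (m == k)%:R else 0 : R[i]) by [].
by apply/funext => -[].
Qed.

End SquareSummable.

(** The Hilbert space ell^2.  The sequences are indexed from 0: the n-th entry
    of an element of [l2 R], and of the coefficients of a Jacobi matrix below,
    is the entry of index n + 1 over {1, 2, ...}. *)
Record l2 (R : realType) := L2 {
  l2val :> nat -> R[i] ;
  l2valP : l2val \in square_summable }.

HB.instance Definition _ (R : realType) := [isSub for @l2val R].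
HB.instance Definition _ (R : realType) := [Choice of l2 R by <:].
HB.instance Definition _ (R : realType) :=
  [SubChoice_isSubLmodule of l2 R by <:].

Section Operators.
Context {R : realType}.
Implicit Types (x y : l2 R) (T : {linear l2 R -> l2 R}) (z : R[i]).

Definition l2norm x : R := Num.sqrt (fine (sqsum x)).

Definition l2inner x y : R[i] :=
  limn (fun n => \sum_(0 <= k < n) x k * conjc (y k) : R[i]^o).

Definition l2basis (k : nat) : l2 R := L2 (square_summable_delta k).

Definition bounded_operator T := exists M : R, forall x, l2norm (T x) <= M * l2norm x.

(** [absolute_value T A]: A = |T|, i.e. A is the nonnegative bounded operator
    with A^2 = T^* T, where S below is the adjoint T^* of T. *)
Definition absolute_value T (A : {linear l2 R -> l2 R}) :=
  [/\ bounded_operator A,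
      forall x, 0 <= l2inner (A x) x &
      exists2 S : {linear l2 R -> l2 R},
        forall x y, l2inner (T x) y = l2inner x (S y) &
        forall x, A (A x) = S (T x)].

Definition trace_class T := bounded_operator T /\
  exists2 A : {linear l2 R -> l2 R}, absolute_value T A &
    (\sum_(0 <= n <oo) (complex.Re (l2inner (A (l2basis n)) (l2basis n)))%:E < +oo)%E.

Definition shifted T z : l2 R -> l2 R := fun x => T x - z *: x.

Definition resolvent_set T : set R[i] :=
  [set z | exists2 B : {linear l2 R -> l2 R}, bounded_operator B &
    cancel (shifted T z) B /\ cancel B (shifted T z)].

Definition spectrum T : set R[i] := ~` resolvent_set T.

Definition eigenvalue_of T z := exists2 x, x != 0 & T x = z *: x.

Definition root_space T z : set (l2 R) :=
  [set x | exists k, iter k (shifted T z) x = 0].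

Definition has_dim (E : set (l2 R)) (n : nat) := exists e : 'I_n -> l2 R,
  (forall u : 'I_n -> R[i], E (\sum_i u i *: e i)) /\
  (forall x, E x -> exists! u : 'I_n -> R[i], x = \sum_i u i *: e i).

(** The algebraic multiplicity is the dimension of the root space; its value
    is irrelevant when that dimension is infinite. *)
Definition alg_mult T z : nat := xget 0%N [set n | has_dim (root_space T z) n].

Definition discrete_spectrum T : set R[i] :=
  [set z | [/\ isolated (spectrum T : set R[i]^o) z, eigenvalue_of T z &
               exists n, has_dim (root_space T z) n]].

End Operators.

Record jacobi (R : realType) := Jacobi {
  subdiag : nat -> R[i] ;
  diag : nat -> R[i] ;
  superdiag : nat -> R[i] ;
  jacobi_bounded : exists M : R, forall n,
    [/\ normc (subdiag n) <= M, normc (diag n) <= M & normc (superdiag n) <= M] ;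
  jacobi_neq0 : forall n, subdiag n * superdiag n != 0 }.

Section JacobiOperator.
Context {R : realType}.
Implicit Types J : jacobi R.

Definition jacobi_seq J (x : nat -> R[i]) (n : nat) : R[i] :=
  (if n is m.+1 then subdiag J m * x m else 0)
  + diag J n * x n + superdiag J n * x n.+1.

Lemma jacobi_seq_summable J (x : l2 R) : jacobi_seq J x \in square_summable.
Proof.
have [M JM] := jacobi_bounded J.
have xs := l2valP x.
have h1 : (fun n => if n is m.+1 then subdiag J m * x m else 0)
    \in square_summable.
  apply: square_summable_shiftr.
  by apply: (@square_summableM _ _ M) => // n; have [] := JM n.
have h2 : (fun n => diag J n * x n) \in square_summable.
  by apply: (@square_summableM _ _ M) => // n; have [] := JM n.
have h3 : (fun n => superdiag J n * x n.+1) \in square_summable.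
  apply: (@square_summableM _ _ M); first by move=> n; have [] := JM n.
  exact: square_summable_shiftl.
exact: square_summableD (square_summableD h1 h2) h3.
Qed.

Definition jacobi_op J (x : l2 R) : l2 R := L2 (jacobi_seq_summable J x).

Lemma jacobi_op_linear J : linear (jacobi_op J).
Proof.
move=> k x y; apply/val_inj/funext => n.
change (jacobi_seq J (fun n => k * x n + y n) n
        = k * jacobi_seq J x n + jacobi_seq J y n).
by rewrite /jacobi_seq; case: n => [|n]; ring.
Qed.

HB.instance Definition _ J :=
  GRing.isLinear.Build R[i] (l2 R) (l2 R) _ (jacobi_op J) (jacobi_op_linear J).

Lemma laplacian_bounded : exists M : R, forall n : nat,
  [/\ normc (1 : R[i]) <= M, normc (0 : R[i]) <= M & normc (1 : R[i]) <= M].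
Proof.
have n1 : normc (1 : R[i]) = 1 := @normc1 R.
have n0 : normc (0 : R[i]) = 0 := @normc0 R.
by exists 1 => n; rewrite n1 n0; split; rewrite ?ler01.
Qed.

Lemma laplacian_neq0 (n : nat) : (1 : R[i]) * 1 != 0.
Proof. by rewrite mulr1 oner_neq0. Qed.

Definition laplacian : jacobi R :=
  @Jacobi R (fun=> 1) (fun=> 0) (fun=> 1) laplacian_bounded laplacian_neq0.

Definition dist_segment (z : R[i]) : R :=
  inf [set normc (z - t%:C) | t in `[-2, 2]%classic].

Definition eigenvalue_sum (eps : R) J : \bar R :=
  (\esum_(z in discrete_spectrum (jacobi_op J))
    ((alg_mult (jacobi_op J) z)%:R *
     (dist_segment z / normc (z ^+ 2 - 4) `^ ((1 - eps) / 2)))%:E)%E.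

Definition Delta J : \bar R :=
  \sum_(0 <= n <oo)
    (normc (diag J n) + normc (1 - subdiag J n * superdiag J n))%:E.

End JacobiOperator.

(* Main.v *)
Require Import Defs.
From mathcomp Require Import all_boot all_order all_algebra.
From mathcomp Require Import all_classical all_reals all_analysis.
From mathcomp Require Import ring lra complex.

Set Implicit Arguments.
Unset Strict Implicit.
Unset Printing Implicit Defensive.

Import Order.TTheory GRing.Theory Num.Theory.
Import numFieldNormedType.Exports.
Import ComplexField.Normc.
Local Open Scope classical_set_scope.
Local Open Scope ring_scope.
Local Open Scope complex_scope.

(** Why the theorem holds.

    The Joukowski map [z + z^-1] sends the punctured unit disc onto the complement
    of [[-2, 2]].  In the variable [z] the term of an eigenvalue is at most
    [2 * (1 - normc z) * (normc (1 - z ^+ 2) / normc z) `^ eps]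
    ([weight_joukowski]), so the claim is a Blaschke type condition on the points
    [z], and these are zeros of the Jost function of the matrix.

    The Jost function is the limit of polynomials [jost b w n] in [z], the Jost
    functions of the truncations.  They depend only on the diagonal entries and on
    the products of opposite off-diagonal entries, are 1 at 0, and have modulus at
    most the exponential of [2 * Delta * normc z / normc (1 - z ^+ 2)]
    ([jost_growth]).  The limit is never taken.  Instead, an eigenvalue of
    algebraic multiplicity [m] has a Jordan chain of length [m] in [l2]
    ([root_space_chain]).  Read as one formal eigenvector modulo [(X - z) ^ m], the
    chain shows that the remainders of the Jost polynomials modulo [(X - z) ^ m]
    tend to zero ([jost_vanishing]); this uses that the superdiagonal entries tend
    to 1, a consequence of the trace class hypothesis ([trace_class_superdiag]).
    By the Chinese remainder theorem, finitely many eigenvalues are treated at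
    once: up to a small error, a Jost polynomial is divisible by the product of the
    corresponding factors ([vanishing_mod_points], [vanishing_zeros_with_growth]).

    The Blaschke type condition comes from Jensen's inequality on suitable parts of
    the disc, proved with the maximum principle for products of moduli of
    polynomials and exponentials of harmonic rational functions
    ([maximum_principle]).  Near 0, the growth exponent is linear in [normc z], and
    so is the number of zeros ([zeros_near_origin]).  Near 1 and -1, the exponent
    is singular, but on the region [2 ^- n <= normc (1 - z ^+ 2)] it has a
    harmonic majorant of size [n] at 0, whence a bound of order [n * Delta] for the
    sum of [1 - normc z ^+ 2] over the zeros of that region
    ([zeros_away_from_edges]).  The factors [normc z `^ - eps] and
    [normc (1 - z ^+ 2) `^ eps] make the sums over the dyadic scales converge
    for [0 < eps < 1] ([sum_zero_weight]). *)

(** * The modulus of a complex number *)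

Section Modulus.
Context {R : realType}.
Implicit Types (z w : R[i]) (a b : R).

Lemma normc_sqrE z : normc z ^+ 2 = complex.Re z ^+ 2 + complex.Im z ^+ 2.
Proof. by case: z => a b /=; rewrite sqr_sqrtr// addr_ge0 ?sqr_ge0. Qed.

Lemma normcX z n : normc (z ^+ n) = normc z ^+ n.
Proof.
elim: n => [|n IHn]; first exact: normc1.
by rewrite !exprS normcM IHn.
Qed.

Lemma normc_conj z : normc (conjc z) = normc z.
Proof. by case: z => a b /=; rewrite sqrrN. Qed.

Lemma normc_real a : normc a%:C = `|a|.
Proof. by rewrite /= expr0n /= addr0 sqrtr_sqr. Qed.

Lemma normc_i z : normc ('i * z) = normc z.
Proof. by rewrite normcM /= expr0n expr1n /= add0r sqrtr1 mul1r. Qed.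

Lemma normc_eq0 z : (normc z == 0) = (z == 0).
Proof.
by apply/eqP/eqP => [/eq0_normc//|->]; exact: normc0.
Qed.

Lemma normc_gt0 z : (0 < normc z) = (z != 0).
Proof. by rewrite lt_neqAle normc_ge0 andbT eq_sym normc_eq0. Qed.

Lemma Re_le_normc z : complex.Re z <= normc z.
Proof.
apply: le_trans (ler_norm _) _.
rewrite -(ler_pXn2r (n := 2)) ?nnegrE ?normc_ge0// normc_sqrE real_normK ?num_real//.
by rewrite lerDl sqr_ge0.
Qed.

Lemma Re_geN_normc z : - normc z <= complex.Re z.
Proof.
by have := Re_le_normc (- z); rewrite normcN lerNl; case: z.
Qed.

Lemma normc_subD z w : normc z - normc w <= normc (z + w).
Proof.
rewrite lerBlDr; have := le_normcD (z + w) (- w).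
by rewrite addrK normcN.
Qed.

Lemma normc_prod (I : Type) (r : seq I) (F : I -> R[i]) :
  normc (\prod_(i <- r) F i) = \prod_(i <- r) normc (F i).
Proof.
by elim/big_rec2: _ => [|i x y _ <-]; [exact: normc1|rewrite normcM].
Qed.

Lemma normc_sum (I : Type) (r : seq I) (F : I -> R[i]) :
  normc (\sum_(i <- r) F i) <= \sum_(i <- r) normc (F i).
Proof.
elim/big_rec2: _ => [|i x y _ IH]; first by rewrite normc0.
by apply: le_trans (le_normcD _ _) _; rewrite lerD2l.
Qed.

Lemma sqr_iC : 'i * 'i = -1 :> R[i].
Proof. by rewrite -expr2 sqr_i. Qed.

Lemma ReM_real a z : complex.Re (a%:C * z) = a * complex.Re z.
Proof. by case: z => x y /=; rewrite mul0r subr0. Qed.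

Lemma ReD z w : complex.Re (z + w) = complex.Re z + complex.Re w.
Proof. by case: z => x y; case: w. Qed.

Lemma mulc_conj z : z * conjc z = (normc z ^+ 2)%:C.
Proof.
rewrite normc_sqrE; case: z => x y; apply/eqP; rewrite eq_complex /=.
by apply/andP; split; apply/eqP; ring.
Qed.

End Modulus.

(** * A maximum principle *)

Section MaximumPrinciple.
Context {R : realType}.
Implicit Types (z c : R[i]) (F G : R[i] -> R).

Definition cross4 F c (h : R) : R :=
  F (c + h%:C) * F (c - h%:C) * F (c + 'i * h%:C) * F (c - 'i * h%:C).

Lemma cross4_le F c (h M : R) : (forall z, 0 <= F z) ->
  F (c + h%:C) <= M -> F (c - h%:C) <= M ->
  F (c + 'i * h%:C) <= M -> F (c - 'i * h%:C) <= M -> cross4 F c h <= M ^+ 4.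
Proof.
move=> F0 h1 h2 h3 h4; rewrite (_ : M ^+ 4 = M * M * M * M); last by ring.
by rewrite !ler_pM ?mulr_ge0.
Qed.

(** A second-order form of the sub-mean value property of [ln F].  The mean over
    a circle is replaced by the mean over the vertices of a small square, because
    for polynomials and rational functions the latter is an explicit algebraic
    expression, which depends on [h] through [h ^+ 4] only. *)
Definition submean F c := exists K, \forall h \near (0 : R)^'+,
  F c ^+ 4 * expR (- (K * h ^+ 4)) <= cross4 F c h.

Lemma submeanM F G c : (forall z, 0 <= F z) -> (forall z, 0 <= G z) ->
  submean F c -> submean G c -> submean (fun z => F z * G z) c.
Proof.
move=> F0 G0 [K FK] [L GL]; exists (K + L).
near=> h; rewrite /cross4.
have -> : (F c * G c) ^+ 4 * expR (- ((K + L) * h ^+ 4)) =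
    (F c ^+ 4 * expR (- (K * h ^+ 4))) * (G c ^+ 4 * expR (- (L * h ^+ 4))).
  by rewrite mulrDl opprD expRD exprMn; ring.
have -> : forall a b c d a' b' c' d' : R, a * a' * (b * b') * (c * c') * (d * d')
   = a * b * c * d * (a' * b' * c' * d') by move=> *; ring.
by apply: ler_pM; rewrite ?mulr_ge0 ?exprn_ge0 ?expR_ge0//; near: h.
Unshelve. all: by end_near. Qed.

Lemma submean_prod (I : eqType) (r : seq I) (F : I -> R[i] -> R) c :
  (forall i z, 0 <= F i z) -> (forall i, i \in r -> submean (F i) c) ->
  submean (fun z => \prod_(i <- r) F i z) c.
Proof.
move=> F0; elim: r => [_|i r IHr FS].
  exists 0; near=> h; rewrite /cross4 !big_nil mul0r oppr0 expR0.
  by rewrite expr1n !mulr1.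
under [X in submean X _]eq_fun do rewrite big_cons.
apply: submeanM => // [z||]; first exact: prodr_ge0.
- exact/FS/mem_head.
- by apply: IHr => j jr; apply: FS; rewrite inE jr orbT.
Unshelve. all: by end_near. Qed.

Lemma submean_const (a : R) c : submean (fun=> a) c.
Proof.
exists 0; near=> h; rewrite /cross4 mul0r oppr0 expR0.
by rewrite mulr1 !exprS expr0 mulr1 !mulrA.
Unshelve. all: by end_near. Qed.

Lemma near0_expr4 (q d : R) : 0 < d -> \forall h \near (0 : R)^'+, q * h ^+ 4 <= d.
Proof.
move=> d0; near=> h.
have h0 : 0 < h by near: h; exact: nbhs_right_gt.
have h1 : h <= 1 by near: h; exact: nbhs_right_le.
have hd : h <= d / (`|q| + 1).
  by near: h; apply: nbhs_right_le; rewrite divr_gt0// ltr_wpDl.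
apply: (@le_trans _ _ (`|q| * h ^+ 4)).
  by rewrite ler_wpM2r ?exprn_ge0 ?ler_norm// ltW.
apply: (@le_trans _ _ ((`|q| + 1) * h)); last first.
  by rewrite mulrC -ler_pdivlMr// ltr_wpDl.
have h0' := ltW h0.
apply: ler_pM => //; rewrite ?exprn_ge0 ?lerDl//.
by rewrite exprS ger_pMr// exprn_ile1.
Unshelve. all: by end_near. Qed.

(** The four vertices are the translates by the fourth roots of [z ^+ 4]. *)
Lemma cross_linear c (z a : R[i]) :
  (c + z - a) * (c - z - a) * (c + 'i * z - a) * (c - 'i * z - a)
  = (c - a) ^+ 4 - z ^+ 4.
Proof.
transitivity ((c - a) ^+ 4 - (1 + 'i * 'i) * (c - a) ^+ 2 * z ^+ 2 + ('i * 'i) * z ^+ 4).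
  by ring.
by rewrite sqr_iC; ring.
Qed.

Lemma submean_linear (a c : R[i]) : submean (fun z => normc (z - a)) c.
Proof.
have [->|ca] := eqVneq c a.
  exists 0; near=> h.
  rewrite subrr normc0 expr0n mul0r /cross4.
  by rewrite !mulr_ge0 ?normc_ge0.
set q := normc (c - a).
have q0 : 0 < q by rewrite normc_gt0 subr_eq0.
exists (2 / q ^+ 4); near=> h.
have h0 : 0 < h by near: h; exact: nbhs_right_gt.
have hq : (1 / q ^+ 4) * h ^+ 4 <= 1 / 2 by near: h; apply: near0_expr4; lra.
rewrite /cross4 -!normcM cross_linear.
apply: le_trans (normc_subD _ _); rewrite normcN !normcX -/q normc_real gtr0_norm//.
set u := (1 / q ^+ 4) * h ^+ 4 in hq.
have -> : q ^+ 4 - h ^+ 4 = q ^+ 4 * (1 - u).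
  by rewrite /u; field; rewrite gt_eqF.
rewrite ler_pM2l ?exprn_gt0//.
have -> : 2 / q ^+ 4 * h ^+ 4 = 2 * u by rewrite /u; ring.
have u0 : 0 <= u by rewrite /u mulr_ge0 ?exprn_ge0 ?ltW// divr_gt0 ?exprn_gt0.
rewrite expRN -[leRHS]invrK lef_pV2 ?posrE ?expR_gt0 ?invr_gt0; last lra.
apply: le_trans (expR_ge1Dx _).
rewrite -[X in X <= _]mul1r ler_pdivrMr; nra.
Unshelve. all: by end_near. Qed.

Lemma submean_poly (p : {poly R[i]}) c : submean (fun z => normc p.[z]) c.
Proof.
have [r ->] := closed_field_poly_normal p.
rewrite (_ : (fun z => _) = fun z =>
  normc (lead_coef p) * \prod_(a <- r) normc (z - a)).
  apply: submeanM => [z|z||]; rewrite ?normc_ge0//.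
  - by apply: prodr_ge0 => *; exact: normc_ge0.
  - exact: submean_const.
  - by apply: submean_prod => *; [exact: normc_ge0|exact: submean_linear].
apply/funext => z; rewrite hornerZ horner_prod normcM normc_prod.
by congr (_ * _); apply: eq_bigr => a _; rewrite !hornerE.
Qed.

(** Summing a simple pole over the vertices gives four times its value at the
    centre, up to a term of order [h ^+ 4].  Both signs of [k] are needed: these
    exponentials serve as harmonic majorants and as compensating factors. *)
Lemma submean_exp_pole (k : R) (a c : R[i]) : c != a ->
  submean (fun z => expR (k * complex.Re (a - z)^-1)) c.
Proof.
move=> ca; pose b : R[i] := a - c.
have b0 : b != 0 by rewrite subr_eq0 eq_sym.
set q := normc b; have q0 : 0 < q by rewrite normc_gt0.
exists (`|k| * (8 / q ^+ 5)); near=> h.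
have h0 : 0 < h by near: h; exact: nbhs_right_gt.
have hq : (1 / q ^+ 4) * h ^+ 4 <= 1 / 2 by near: h; apply: near0_expr4; lra.
have hq' : h ^+ 4 <= q ^+ 4 / 2.
  by move: hq; rewrite mul1r mulrC ler_pdivrMr ?exprn_gt0// mul1r mulrC.
pose x : R[i] := h%:C.
have nx : normc (x ^+ 4) = h ^+ 4 by rewrite normcX normc_real gtr0_norm.
have nb : normc (b ^+ 4) = q ^+ 4 by rewrite normcX.
have P0 : b ^+ 4 - x ^+ 4 != 0.
  rewrite -normc_gt0; apply: lt_le_trans (normc_subD _ _).
  rewrite normcN nx nb subr_gt0; apply: le_lt_trans hq' _.
  by rewrite ltr_pdivrMr// ltr_pMr ?exprn_gt0// ltr1n.
have PE : (b - x) * (b + x) * (b - 'i * x) * (b + 'i * x) = b ^+ 4 - x ^+ 4.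
  transitivity (b ^+ 4 - (1 + 'i * 'i) * b ^+ 2 * x ^+ 2 + ('i * 'i) * x ^+ 4).
    by ring.
  by rewrite sqr_iC; ring.
have [x1 x2 x3 x4] : [/\ b - x != 0, b + x != 0, b - 'i * x != 0 &
     b + 'i * x != 0].
  by move: P0; rewrite -PE !mulf_eq0 !negb_or => /andP[/andP[/andP[-> ->] ->] ->].
have SE : (b - x)^-1 + (b + x)^-1 + (b - 'i * x)^-1 + (b + 'i * x)^-1
  = 4 * b^-1 + 4 * x ^+ 4 / (b * (b ^+ 4 - x ^+ 4)).
  have -> : (b - x)^-1 + (b + x)^-1 + (b - 'i * x)^-1 + (b + 'i * x)^-1 =
     ((b + x) * (b - 'i * x) * (b + 'i * x) + (b - x) * (b - 'i * x) * (b + 'i * x)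
     + (b - x) * (b + x) * (b + 'i * x) + (b - x) * (b + x) * (b - 'i * x)) /
      ((b - x) * (b + x) * (b - 'i * x) * (b + 'i * x)).
    by field; rewrite x1 x2 x3 x4.
  have -> : (b + x) * (b - 'i * x) * (b + 'i * x) + (b - x) * (b - 'i * x) * (b + 'i * x)
     + (b - x) * (b + x) * (b + 'i * x) + (b - x) * (b + x) * (b - 'i * x) = 4 * b ^+ 3.
    transitivity (4 * b ^+ 3 - 2 * (1 + 'i * 'i) * b * x ^+ 2).
      by ring.
    by rewrite sqr_iC; ring.
  by rewrite PE; field; rewrite b0 P0.
have E4 : normc (4 * x ^+ 4 / (b * (b ^+ 4 - x ^+ 4))) <= 8 / q ^+ 5 * h ^+ 4.
  rewrite [normc _]normcM normcV [normc (4 * _)]normcM [normc (b * _)]normcM nx -/q.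
  have -> : normc (4 : R[i]) = 4.
    by rewrite (_ : 4 = (4%:R)%:C) ?normc_real ?ger0_norm// rmorph_nat.
  have : q ^+ 4 / 2 <= normc (b ^+ 4 - x ^+ 4).
    by apply: le_trans (normc_subD _ _); rewrite normcN nx nb; lra.
  set P := normc _ => PP.
  have P0' : 0 < P by apply: lt_le_trans PP; rewrite divr_gt0 ?exprn_gt0.
  rewrite mulrAC ler_pM2r ?exprn_gt0//.
  rewrite ler_pdivrMr ?mulr_gt0// mulrAC ler_pdivlMr ?exprn_gt0//.
  rewrite [q ^+ 5]exprS; nra.
rewrite /cross4 -!expRD -[X in X * _ <= _]expRM_natl -expRD ler_expR.
rewrite -!mulrDr -!ReD.
have -> : (a - (c + x))^-1 + (a - (c - x))^-1 + (a - (c + 'i * x))^-1 + (a - (c - 'i * x))^-1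
  = 4 * b^-1 + 4 * x ^+ 4 / (b * (b ^+ 4 - x ^+ 4)).
  by rewrite -SE /b !opprD !opprK !addrA.
rewrite ReD -/b.
have -> : complex.Re (4 * b^-1) = 4 * complex.Re b^-1.
  by rewrite (_ : 4 = (4%:R)%:C) ?ReM_real// rmorph_nat.
rewrite mulrDr (mulrCA k 4) lerD2l.
set Z := 4 * x ^+ 4 / _ in E4 *.
have [k0|k0] := leP 0 k.
  have := Re_geN_normc Z; rewrite ger0_norm//; nra.
have := Re_le_normc Z; rewrite ltr0_norm//; nra.
Unshelve. all: by end_near. Qed.

Lemma cross4_exp_normc2 (d : R) c (h : R) :
  cross4 (fun z => expR (d * normc z ^+ 2)) c h =
  expR (d * normc c ^+ 2) ^+ 4 * expR (4 * d * h ^+ 2).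
Proof.
rewrite /cross4 -!expRD -expRM_natl -expRD; congr expR.
by case: c => x y; rewrite !normc_sqrE /=; ring.
Qed.

(** Closed bounded sets of pairs are compact, as closed subsets of a product of
    segments; maxima over subsets of the plane are taken there. *)
Definition cplx (q : R * R) : R[i] := q.1 +i* q.2.

(** The strictly subharmonic factor [expR (d * normc z ^+ 2)] makes an interior
    maximum impossible: the gain is quadratic in the size of the cross and
    dominates the quartic error allowed by [submean]. *)
Lemma maximum_principle (X : set (R * R)) (F : R[i] -> R) (m : R) (c : R * R) :
  compact X -> (forall q, X q -> {for q, continuous (F \o cplx)}) ->
  (forall q, X q -> normc (cplx q) <= 1) ->
  (forall z, 0 <= F z) -> 0 < m ->
  (forall q, X q -> F (cplx q) <= m \/ submean F (cplx q) /\
     \forall h \near (0 : R)^'+, forall k : R[i], k \in [:: 1; - 1; 'i; - 'i] ->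
       exists2 q', X q' & cplx q' = cplx q + k * h%:C) ->
  X c -> F (cplx c) <= m.
Proof.
move=> cX Fc X1 F0 m0 Fm Xc; rewrite leNgt; apply/negP => mF.
(* Small enough that the extra factor, at most [expR d], keeps [c] above [m]. *)
pose d := ln (F (cplx c) / m) / 2.
have d0 : 0 < d by rewrite divr_gt0// ln_gt0// ltr_pdivlMr// mul1r.
have md : m * expR d < F (cplx c).
  have Fc0 : 0 < F (cplx c) / m by rewrite divr_gt0// (lt_trans m0).
  rewrite -ltr_pdivlMl// mulrC -[ltRHS]lnK ?posrE// ltr_expR.
  by move: d0; rewrite /d; lra.
pose E (z : R[i]) := expR (d * normc z ^+ 2).
pose G z := F z * E z.
have [||q] := @compact_EVT_max _ _ (G \o cplx) X _ cX.
  by exists c.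
- apply: continuous_in_subspaceT => q /set_mem Xq.
  have c1 : {for q, continuous (fst : R * R -> R)} by exact: cvg_fst.
  have c2 : {for q, continuous (snd : R * R -> R)} by exact: cvg_snd.
  have c3 : {for q, continuous (fun q : R * R => d * (q.1 * q.1 + q.2 * q.2))}.
    apply: cvgM; first exact: cvg_cst.
    by apply: cvgD; apply: cvgM.
  have Ec : {for q, continuous (E \o cplx)}.
    have -> : E \o cplx = expR \o (fun q : R * R => d * (q.1 * q.1 + q.2 * q.2)).
      by apply/funext => p; rewrite /E /comp normc_sqrE /= !expr2.
    by apply: continuous_comp => //; exact: continuous_expR.
  by apply: cvgM => //; exact: Fc.
move=> /set_mem Xq /(_ _ (mem_set _)) Gq.
have Fq : m < F (cplx q).
  have Ed z : normc z <= 1 -> 1 <= E z <= expR d.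
    move=> z1; apply/andP; split.
      by rewrite -[leLHS]expR0 ler_expR mulr_ge0 ?exprn_ge0 ?normc_ge0// ltW.
    by rewrite ler_expR ger_pMr// exprn_ile1// normc_ge0.
  have /andP[Ec _] := Ed _ (X1 _ Xc).
  have /andP[_ Eq] := Ed _ (X1 _ Xq).
  have FG : F (cplx c) <= G (cplx c) by rewrite /G ler_peMr.
  have : m * expR d < F (cplx q) * expR d.
    apply: lt_le_trans md (le_trans FG (le_trans (Gq c Xc) _)).
    by rewrite /= /G ler_wpM2l.
  by rewrite ltr_pM2r ?expR_gt0.
have [Fle|[[K FK] Xh]] := Fm q Xq; first by rewrite leNgt Fq in Fle.
have Fq0 : 0 < F (cplx q) := lt_trans m0 Fq.
have Gq0 : 0 < G (cplx q) by rewrite mulr_gt0 ?expR_gt0.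
suff : \forall h \near (0 : R)^'+, False by case/filter_ex.
near=> h.
have h0 : 0 < h by near: h; exact: nbhs_right_gt.
have XG k : k \in [:: 1; - 1; 'i; - 'i] -> G (cplx q + k * h%:C) <= G (cplx q).
  move=> kU; have : exists2 q', X q' & cplx q' = cplx q + k * h%:C.
    by move: k kU; near: h.
  by move=> [q' Xq' <-]; exact: Gq.
have Gle : cross4 G (cplx q) h <= G (cplx q) ^+ 4.
  apply: cross4_le => [z||||]; first by rewrite mulr_ge0 ?F0 ?expR_ge0.
  - by rewrite -[h%:C]mul1r; apply: XG; rewrite !inE eqxx.
  - by rewrite -[h%:C]mul1r -mulNr; apply: XG; rewrite !inE eqxx orbT.
  - by apply: XG; rewrite !inE eqxx !orbT.
  - by rewrite -mulNr; apply: XG; rewrite !inE eqxx !orbT.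
have GE : cross4 G (cplx q) h = cross4 F (cplx q) h * cross4 E (cplx q) h.
  by rewrite /cross4 /G; ring.
have EE : cross4 E (cplx q) h = E (cplx q) ^+ 4 * expR (4 * d * h ^+ 2).
  exact: cross4_exp_normc2.
have FKh : F (cplx q) ^+ 4 * expR (- (K * h ^+ 4)) <= cross4 F (cplx q) h.
  by near: h.
have : G (cplx q) ^+ 4 * expR (- (K * h ^+ 4) + 4 * d * h ^+ 2) <= G (cplx q) ^+ 4.
  apply: le_trans Gle; rewrite GE EE expRD exprMn.
  rewrite mulrACA ler_wpM2r// ?mulr_ge0 ?exprn_ge0 ?expR_ge0//.
rewrite ger_pMr ?exprn_gt0// -[leRHS]expR0 ler_expR.
have Kh : K * h ^+ 4 <= 2 * d * h ^+ 2.
  have hh : h <= 1 by near: h; exact: nbhs_right_le.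
  have hd : h <= d / (`|K| + 1).
    by near: h; apply: nbhs_right_le; rewrite divr_gt0// ltr_wpDl.
  rewrite ler_pdivlMr ?ltr_wpDl// in hd.
  have KK := ler_norm K.
  have -> : K * h ^+ 4 = (K * h * h) * h ^+ 2 by ring.
  rewrite ler_wpM2r ?exprn_ge0 ?(ltW h0)//.
  have Kd : K * h <= d by nra.
  have [Kh0|Kh0] := leP 0 (K * h).
    apply: (@le_trans _ _ (K * h)); first by rewrite ler_piMr.
    by apply: le_trans Kd _; rewrite ler_peMl ?ltW// ltr1n.
  apply: (@le_trans _ _ 0); first by rewrite nmulr_rle0 ?ltW.
  by rewrite mulr_ge0 ?ltW.
have dh : 0 < d * h ^+ 2 by rewrite mulr_gt0 ?exprn_gt0.
have -> : 4 * d * h ^+ 2 = 2 * (2 * d * h ^+ 2) by ring.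
rewrite -mulrA in Kh *.
by move: dh Kh; generalize (d * h ^+ 2) (K * h ^+ 4) => u v; lra.
Unshelve. all: by end_near. Qed.

End MaximumPrinciple.

(** * Moduli of polynomials and rational functions on a truncated disc *)

Section TruncatedDisc.
Context {R : realType}.
Implicit Types (z w : R[i]) (p : {poly R[i]}) (l : seq (R * R)) (rho delta : R).

Lemma continuous_at_eq (T U : topologicalType) (f g : T -> U) (x : T) :
  f =1 g -> {for x, continuous g} -> {for x, continuous f}.
Proof. by move=> /funext ->. Qed.

Lemma continuous_Re_Im_horner p (q : R * R) :
  {for q, continuous (fun q : R * R => complex.Re p.[cplx q])} /\
  {for q, continuous (fun q : R * R => complex.Im p.[cplx q])}.
Proof.
have c1 : {for q, continuous (fst : R * R -> R)} by exact: cvg_fst.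
have c2 : {for q, continuous (snd : R * R -> R)} by exact: cvg_snd.
elim/poly_ind: p => [|p c [IH1 IH2]].
  by split; apply: (@continuous_at_eq _ _ _ (fun=> 0)) => [q'|];
    rewrite ?horner0//; exact: cvg_cst.
split.
  apply: (@continuous_at_eq _ _ _ (fun q' : R * R => complex.Re p.[cplx q'] * q'.1
     - complex.Im p.[cplx q'] * q'.2 + complex.Re c)) => [q'|].
    by rewrite hornerMXaddC; case: (p.[_]) => a b; case: c.
  by apply: cvgD; [apply: cvgB; apply: cvgM|exact: cvg_cst].
apply: (@continuous_at_eq _ _ _ (fun q' : R * R => complex.Re p.[cplx q'] * q'.2
   + complex.Im p.[cplx q'] * q'.1 + complex.Im c)) => [q'|].
  by rewrite hornerMXaddC; case: (p.[_]) => a b; case: c.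
by apply: cvgD; [apply: cvgD; apply: cvgM|exact: cvg_cst].
Qed.

Lemma continuous_normc_horner p (q : R * R) :
  {for q, continuous (fun q : R * R => normc p.[cplx q])}.
Proof.
have [c1 c2] := continuous_Re_Im_horner p q.
apply: (@continuous_at_eq _ _ _ (Num.sqrt \o (fun q' : R * R =>
   complex.Re p.[cplx q'] ^+ 2 + complex.Im p.[cplx q'] ^+ 2))) => [q'|].
  by rewrite /=; case: (p.[_]).
apply: continuous_comp; last exact: sqrt_continuous.
by apply: cvgD; apply: cvgM.
Qed.

Lemma continuous_Re_inv_horner p (q : R * R) : p.[cplx q] != 0 ->
  {for q, continuous (fun q : R * R => complex.Re (p.[cplx q])^-1)}.
Proof.
move=> p0; have [c1 c2] := continuous_Re_Im_horner p q.
apply: (@continuous_at_eq _ _ _ (fun q' : R * R => complex.Re p.[cplx q'] /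
   (complex.Re p.[cplx q'] ^+ 2 + complex.Im p.[cplx q'] ^+ 2))) => [q'|].
  by case: (p.[_]).
apply: cvgM => //; apply: cvgV; last by apply: cvgD; apply: cvgM.
by rewrite -normc_sqrE expf_eq0 /= normc_eq0.
Qed.

(** The modulus of a polynomial times the exponential of a real combination of
    the harmonic functions [Re (1 / (a - z))], [a] real: the logarithm is
    subharmonic away from the poles. *)
Definition harmonic_weight p l z : R :=
  normc p.[z] * \prod_(e <- l) expR (e.1 * complex.Re (e.2%:C - z)^-1).

Lemma harmonic_weightE p l z : harmonic_weight p l z =
  normc p.[z] * expR (\sum_(e <- l) e.1 * complex.Re (e.2%:C - z)^-1).
Proof. by rewrite /harmonic_weight expR_sum. Qed.

Lemma harmonic_weight_ge0 p l z : 0 <= harmonic_weight p l z.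
Proof. by rewrite harmonic_weightE mulr_ge0 ?normc_ge0 ?expR_ge0. Qed.

(** For [rho = 1] and [0 < delta] this is the unit disc without neighbourhoods of
    the points 1 and -1; for [delta = 0] it is a disc. *)
Definition truncated_disc rho delta : set R[i] :=
  [set z | normc z <= rho /\ delta <= normc (1 - z ^+ 2)].

Lemma compact_truncated_disc rho delta :
  compact (@cplx R @^-1` truncated_disc rho delta).
Proof.
have poly_closed p (D : set R) : closed D ->
    closed ((fun q : R * R => normc p.[cplx q]) @^-1` D).
  move=> cD; apply: preimage_closed => // q _.
  exact: continuous_normc_horner.
have -> : @cplx R @^-1` truncated_disc rho delta =
    (fun q : R * R => normc ('X : {poly R[i]}).[cplx q]) @^-1` [set x | x <= rho] `&`
    (fun q : R * R => normc (1 - 'X ^+ 2 : {poly R[i]}).[cplx q]) @^-1` [set x | delta <= x].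
  by apply/seteqP; split => q /=; rewrite !hornerE.
apply: (@subclosed_compact _ _ (`[- rho, rho] `*` `[- rho, rho])).
- by apply: closedI; apply: poly_closed; [exact: closed_le|exact: closed_ge].
- by apply: compact_setX; exact: segment_compact.
move=> [x y] [/=]; rewrite hornerX => xy _.
have rho0 : 0 <= rho := le_trans (normc_ge0 _) xy.
move: xy; rewrite -(ler_pXn2r (n := 2)) ?nnegrE ?normc_ge0// normc_sqrE /= => xy.
rewrite !in_itv /= -!ler_norml -!(ler_pXn2r (n := 2) _ (normr_ge0 _)) ?nnegrE//.
rewrite !real_normK ?num_real//; have := sqr_ge0 x; have := sqr_ge0 y; lra.
Qed.

Lemma truncated_disc_interior rho delta z k : normc z < rho -> rho <= 1 ->
  delta < normc (1 - z ^+ 2) -> normc k = 1 ->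
  \forall h \near (0 : R)^'+, truncated_disc rho delta (z + k * h%:C).
Proof.
move=> zr r1 zd k1; near=> h.
have h0 : 0 < h by near: h; exact: nbhs_right_gt.
have h1 : h <= 1 by near: h; exact: nbhs_right_le.
have hr : h <= rho - normc z by near: h; apply: nbhs_right_le; rewrite subr_gt0.
have hd : h <= (normc (1 - z ^+ 2) - delta) / 3.
  by near: h; apply: nbhs_right_le; rewrite divr_gt0// subr_gt0.
have nkh : normc (k * h%:C) = h by rewrite normcM k1 mul1r normc_real gtr0_norm.
split; first by have := le_normcD z (k * h%:C); rewrite nkh; lra.
have -> : 1 - (z + k * h%:C) ^+ 2 = (1 - z ^+ 2) + - (k * h%:C * (2 * z + k * h%:C)).
  by ring.
apply: le_trans (normc_subD _ _); rewrite normcN normcM nkh.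
have : normc (2 * z + k * h%:C) <= 3.
  apply: le_trans (le_normcD _ _) _; rewrite nkh normcM.
  have -> : normc (2 : R[i]) = 2.
    by rewrite (_ : 2 = (2%:R)%:C) ?normc_real ?ger0_norm// rmorph_nat.
  by lra.
by nra.
Unshelve. all: by end_near. Qed.

Lemma harmonic_weight_le p l rho delta m : 0 <= rho <= 1 -> delta <= 1 -> 0 < m ->
  (forall e z, e \in l -> truncated_disc rho delta z -> z != e.2%:C) ->
  (forall z, truncated_disc rho delta z ->
     normc z = rho \/ normc (1 - z ^+ 2) = delta -> harmonic_weight p l z <= m) ->
  harmonic_weight p l 0 <= m.
Proof.
move=> /andP[rho0 rho1] delta1 m0 poles bdry.
have <- : cplx (0 : R * R) = 0 by [].
apply: (maximum_principle (@compact_truncated_disc rho delta)) => //.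
- move=> q Xq; apply: cvgM; first exact: continuous_normc_horner.
  apply: (@continuous_at_eq _ _ _ (expR \o (fun q : R * R =>
    \sum_(e <- l) e.1 * complex.Re (e.2%:C - cplx q)^-1))) => [q'|].
    by rewrite /= expR_sum.
  apply: continuous_comp; last exact: continuous_expR.
  elim: l poles {bdry} => [|e l IHl] poles.
    by apply: (@continuous_at_eq _ _ _ (fun=> 0)) => [q'|];
      rewrite ?big_nil//; exact: cvg_cst.
  apply: (@continuous_at_eq _ _ _ (fun q : R * R =>
     e.1 * complex.Re (e.2%:C - cplx q)^-1 +
     \sum_(e <- l) e.1 * complex.Re (e.2%:C - cplx q)^-1)) => [q'|].
    by rewrite big_cons.
  apply: cvgD; last by apply: IHl => e' z e'l; apply: poles; rewrite inE e'l orbT.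
  apply: cvgM; first exact: cvg_cst.
  apply: (@continuous_at_eq _ _ _ (fun q : R * R =>
     complex.Re (e.2%:C%:P - 'X).[cplx q]^-1)) => [q'|]; first by rewrite !hornerE.
  apply: continuous_Re_inv_horner.
  by rewrite !hornerE subr_eq0 eq_sym (poles _ _ (mem_head _ _) Xq).
- by move=> q [Xq _]; exact: le_trans Xq rho1.
- exact: harmonic_weight_ge0.
- move=> q Xq; have [zr|] := eqVneq (normc (cplx q)) rho; first by left; apply: bdry; auto.
  have [zd _|] := eqVneq (normc (1 - cplx q ^+ 2)) delta; first by left; apply: bdry; auto.
  have [z1 z2] := Xq.
  rewrite !neq_lt (ltNge _ delta) (ltNge rho) z1 z2 /= orbF => zd zr; right; split.
    apply: submeanM => [z|z||]; first exact: normc_ge0.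
    - by apply: prodr_ge0 => *; exact: expR_ge0.
    - exact: submean_poly.
    - apply: submean_prod => *; first exact: expR_ge0.
      by apply: submean_exp_pole; exact: poles Xq.
  have ni : normc 'i = 1 :> R by rewrite -[X in normc X]mulr1 normc_i normc1.
  have H k : normc k = 1 ->
      \forall h \near (0 : R)^'+, truncated_disc rho delta (cplx q + k * h%:C).
    exact: truncated_disc_interior.
  have pre z : truncated_disc rho delta z ->
      exists2 q', (@cplx R @^-1` truncated_disc rho delta) q' & cplx q' = z.
    by case: z => x y xy; exists (x, y).
  near=> h.
  have h1 : truncated_disc rho delta (cplx q + 1 * h%:C).
    by near: h; apply: H; exact: normc1.
  have h2 : truncated_disc rho delta (cplx q + (- 1) * h%:C).
    by near: h; apply: H; rewrite normcN; exact: normc1.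
  have h3 : truncated_disc rho delta (cplx q + 'i * h%:C) by near: h; exact: H.
  have h4 : truncated_disc rho delta (cplx q + (- 'i) * h%:C).
    by near: h; apply: H; rewrite normcN.
  by move=> k; rewrite !inE => /or4P[]/eqP ->; exact: pre.
- split; first by have -> : cplx (0 : R * R) = 0 by []; rewrite normc0.
  by have -> : cplx (0 : R * R) = 0 by []; rewrite expr0n subr0 normc1.
Unshelve. all: by end_near. Qed.

End TruncatedDisc.

(** * Counting zeros under a bound that is singular at -1 and 1 *)

Section ZeroCounting.
Context {R : realType}.
Implicit Types (z w : R[i]) (s : seq R[i]) (K : R).

Definition root_prod s : {poly R[i]} := \prod_(z <- s) ('X - z%:P).

(** The points of [s], repeated according to multiplicity, behave as zeros of an
    analytic function on the unit disc with value 1 at 0 and with modulus at most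
    [expR (K * normc x / normc (1 - x ^+ 2))].  That function is only present
    through polynomial approximations with exactly these zeros, which is why the
    bounds have an error [d]. *)
Definition zeros_with_growth K s := forall d : R, 0 < d ->
  exists2 g : {poly R[i]},
    forall x, normc x <= 1 -> x ^+ 2 != 1 ->
      normc (root_prod s * g).[x] <= expR (K * normc x / normc (1 - x ^+ 2)) + d &
    1 - d <= normc (root_prod s * g).[0].

Lemma zeros_with_growth_filter K s (P : pred R[i]) :
  zeros_with_growth K s -> zeros_with_growth K [seq z <- s | P z].
Proof.
move=> sK d d0; have [g g1 g2] := sK d d0.
exists (root_prod [seq z <- s | ~~ P z] * g) => [x|]; last first.
  move: g2; congr (_ <= normc _.[_]).
  rewrite mulrA /root_prod; congr (_ * _).
  by rewrite !big_filter [LHS](bigID P).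
move=> x1 x2; have := g1 x x1 x2; congr (normc _.[_] <= _).
rewrite mulrA /root_prod; congr (_ * _).
by rewrite !big_filter [LHS](bigID P).
Qed.

Lemma normc_root_prod s z : normc (root_prod s).[z] = \prod_(a <- s) normc (z - a).
Proof.
by rewrite horner_prod normc_prod; apply: eq_bigr => a _; rewrite !hornerE.
Qed.

(** The numerator of a Blaschke product for the disc of radius [rho]. *)
Definition reflected_prod (rho : R) s : {poly R[i]} :=
  \prod_(a <- s) ((rho ^+ 2)%:C%:P - (conjc a)%:P * 'X).

Lemma normc_reflected_prod rho s z : normc (reflected_prod rho s).[z] =
  \prod_(a <- s) normc ((rho ^+ 2)%:C - conjc a * z).
Proof.
by rewrite horner_prod normc_prod; apply: eq_bigr => a _; rewrite !hornerE.
Qed.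

Lemma prod_le_exp s (F : R[i] -> R) (c : R) :
  (forall z, z \in s -> 0 <= F z <= c) -> \prod_(z <- s) F z <= c ^+ size s.
Proof.
elim: s => [|z s IHs] Fc; first by rewrite big_nil expr0.
have /andP[F0 F1] := Fc z (mem_head _ _).
have Fs x : x \in s -> 0 <= F x <= c by move=> xs; apply: Fc; rewrite inE xs orbT.
rewrite big_cons exprS ler_pM//; last exact: IHs.
by rewrite big_seq; apply: prodr_ge0 => x /Fs/andP[].
Qed.

Lemma reflected_on_circle (rho : R) z a : normc z = rho ->
  normc ((rho ^+ 2)%:C - conjc a * z) = rho * normc (z - a).
Proof.
move=> <-; rewrite -[normc z in RHS]normc_conj -normcM.
rewrite -[LHS]normc_conj; congr normc; case: z => x y; case: a => u v.
by rewrite normc_sqrE; apply/eqP; rewrite eq_complex /=; apply/andP; split; apply/eqP; ring.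
Qed.

Lemma reflected_prod_on_circle (rho : R) s z : normc z = rho ->
  normc (reflected_prod rho s).[z] = rho ^+ size s * normc (root_prod s).[z].
Proof.
move=> zr; rewrite normc_reflected_prod normc_root_prod.
elim: s => [|a s IHs]; first by rewrite !big_nil mulr1.
by rewrite !big_cons IHs reflected_on_circle// exprS; ring.
Qed.

Lemma reflected_prod0 (rho : R) s :
  normc (reflected_prod rho s).[0] = rho ^+ (2 * size s).
Proof.
rewrite normc_reflected_prod exprM; elim: s => [|a s IHs]; first by rewrite big_nil expr0.
by rewrite big_cons IHs mulr0 subr0 normc_real ger0_norm ?sqr_ge0 -?exprS.
Qed.

Lemma expR_half_le2 : expR (2^-1) <= 2 :> R.
Proof.
rewrite -ler_pV2 ?inE ?unitfE ?gt_eqF ?expR_gt0 ?divr_gt0//=.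
by rewrite -expRN; apply: le_trans (expR_ge1Dx _); lra.
Qed.

(** Jensen's inequality on the disc of radius [rho]: dividing by the Blaschke
    factors of the zeros does not change the modulus on the circle and gains a
    factor 2 at the origin for each zero.  Since the exponent in the growth bound
    vanishes at 0, the number of zeros is linear in [rho]. *)
Lemma zeros_near_origin K s (rho : R) : 0 < rho < 1 -> 0 <= K ->
  zeros_with_growth K s -> (forall z, z \in s -> normc z <= rho / 2) ->
  (size s)%:R / 2 <= K * rho / (1 - rho ^+ 2).
Proof.
move=> /andP[rho0 rho1] K0 sK small.
have r2 : 0 < 1 - rho ^+ 2 by rewrite subr_gt0 expr_lt1// ltW.
set B := K * rho / _; set N := size s.
suff H : 2 ^+ N <= expR B.
  rewrite -ler_expR; apply: le_trans H.
  by rewrite expRM_natl lerXn2r ?nnegrE ?expR_ge0// expR_half_le2.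
suff main d : 0 < d -> 1 - d <= 2^-1 ^+ N * expR B + d.
  have : 1 <= 2^-1 ^+ N * expR B.
    apply/ler_addgt0Pr => e e0; have := main (e / 2) (divr_gt0 e0 _); lra.
  by rewrite exprVn ler_pdivlMl ?exprn_gt0// mulr1.
move=> d0; have [g g1 g2] := sK d d0.
pose p := g * reflected_prod rho s.
pose m := rho ^+ N * (expR B + d).
have m0 : 0 < m by rewrite mulr_gt0 ?exprn_gt0// addr_gt0 ?expR_gt0.
have far z : normc z <= rho -> 1 - rho ^+ 2 <= normc (1 - z ^+ 2).
  move=> zr; apply: le_trans (normc_subD _ _); rewrite normc1 normcN normcX lerD2l lerN2.
  by rewrite lerXn2r ?nnegrE ?normc_ge0// ltW.
have : harmonic_weight p [::] 0 <= m.
  apply: (@harmonic_weight_le _ _ _ rho 0) => //; first by rewrite !ltW.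
  move=> z [z1 _] []; last by have := far z z1; lra.
  move=> zr; rewrite /harmonic_weight big_nil mulr1 hornerM normcM.
  rewrite reflected_prod_on_circle// mulrCA ler_pM2l ?exprn_gt0//.
  rewrite -normcM mulrC -hornerM; apply: le_trans (g1 _ _ _) _.
  - by rewrite zr ltW.
  - rewrite -subr_eq0 -normc_eq0 -normcN opprB gt_eqF//.
    by apply: lt_le_trans (far z z1).
  rewrite lerD2r ler_expR zr /B ler_pM ?mulr_ge0 ?invr_ge0 ?normc_ge0 ?(ltW rho0)//.
  by rewrite lef_pV2 ?posrE ?far// (lt_le_trans r2)// far.
rewrite /harmonic_weight big_nil mulr1 hornerM normcM reflected_prod0.
rewrite mul2n -addnn exprD mulrCA ler_pM2l ?exprn_gt0// => gle.
apply: le_trans g2 _; rewrite hornerM normcM normc_root_prod.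
apply: (@le_trans _ _ ((rho / 2) ^+ N * normc g.[0])).
  rewrite ler_wpM2r ?normc_ge0//; apply: prod_le_exp => z /small.
  by rewrite sub0r normcN normc_ge0.
rewrite exprMn mulrAC mulrC [_ * normc _]mulrC.
apply: (@le_trans _ _ (2^-1 ^+ N * (expR B + d))).
  by rewrite ler_wpM2l// exprn_ge0.
rewrite mulrDr lerD2l ler_piMl ?(ltW d0)//.
by rewrite exprn_ile1// ?invr_ge0// invf_le1// ler1n.
Qed.

(** The functions [Re (1 / (a - w))], [a > 1], are positive on the disc, and the
    one with [a - 1] comparable to [2 ^- k] is comparable to
    [1 / normc (1 - w)] when [normc (1 - w)] is.  A sum of [n.+1] of them thus
    majorizes on all scales down to [2 ^- n], while it is at most [n.+1] at 0.
    The numbers [a] are squares so that [a - z ^+ 2] splits over the reals. *)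
Lemma harmonic_majorant n w : normc w <= 1 -> 2^-1 ^+ n <= normc (1 - w) ->
  (normc (1 - w))^-1 <=
    6 * \sum_(k < n.+1) complex.Re (((1 + 2^-1 ^+ k) ^+ 2)%:C - w)^-1.
Proof.
have pos k : normc w <= 1 -> 0 <= complex.Re (((1 + 2^-1 ^+ k) ^+ 2)%:C - w)^-1.
  move=> w1; have := le_trans (Re_le_normc w) w1; case: (w) => x y /= xw.
  have h0 : 0 < 2^-1 ^+ k :> R by rewrite exprn_gt0 ?invr_gt0.
  by apply: divr_ge0; [nra|rewrite addr_ge0 ?sqr_ge0].
have at_scale k : normc w <= 1 -> 2^-1 ^+ k <= normc (1 - w) <= 2 * 2^-1 ^+ k ->
    (normc (1 - w))^-1 <= 6 * complex.Re (((1 + 2^-1 ^+ k) ^+ 2)%:C - w)^-1.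
  move=> w1; have h0 : 0 < 2^-1 ^+ k :> R by rewrite exprn_gt0 ?invr_gt0.
  have h1 : 2^-1 ^+ k <= 1 :> R by rewrite exprn_ile1// ?invr_ge0// invf_le1// ler1n.
  move: (2^-1 ^+ k) h0 h1 => h h0 h1 /andP[hw wh].
  have Rw : 0 <= complex.Re (1 - w).
    have := le_trans (Re_le_normc w) w1.
    by case: (w) => x y /= xw; lra.
  have -> : ((1 + h) ^+ 2)%:C - w = (1 - w) + (2 * h + h ^+ 2)%:C.
    by apply/eqP; case: (w) => x y; rewrite eq_complex /=;
      apply/andP; split; apply/eqP; ring.
  have := normc_sqrE (1 - w).
  case: (1 - w) hw wh Rw => x y; set r := normc _ => hw wh /= Rw rE.
  have r0 : 0 < r by apply: lt_le_trans hw.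
  have den : 0 < (x + (2 * h + h ^+ 2)) ^+ 2 + (y + 0) ^+ 2.
    have : 0 < (x + (2 * h + h ^+ 2)) ^+ 2 by rewrite exprn_gt0//; nra.
    by have := sqr_ge0 (y + 0); lra.
  have xr : x <= r.
    by rewrite -(ler_pXn2r (n := 2)) ?nnegrE ?(ltW r0)// rE lerDl sqr_ge0.
  rewrite mulrA ler_pdivlMr// mulrC ler_pdivrMr// addr0.
  have -> : (x + (2 * h + h ^+ 2)) ^+ 2 + y ^+ 2
     = r ^+ 2 + 2 * x * (2 * h + h ^+ 2) + (2 * h + h ^+ 2) ^+ 2 by rewrite rE; ring.
  have u1 : 2 * h <= 2 * h + h ^+ 2 by rewrite lerDl sqr_ge0.
  have u2 : 2 * h + h ^+ 2 <= 3 * h by nra.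
  have u0 : 0 < 2 * h + h ^+ 2 by lra.
  move: (2 * h + h ^+ 2) u0 u1 u2 => u u0 u1 u2.
  have e1 : r ^+ 2 <= r * u by rewrite expr2 ler_pM2l//; lra.
  have e2 : x * u <= r * u by rewrite ler_pM2r.
  have e3 : u ^+ 2 <= 3 * (r * u) by nra.
  have e4 : 0 <= r * x by rewrite mulr_ge0// ltW.
  by nra.
elim: n => [|n IHn] w1 wn.
  rewrite big_ord_recl big_ord0 addr0; apply: (at_scale 0) => //.
  rewrite wn expr0 mulr1; apply: le_trans (le_normcD _ _) _.
  by rewrite normcN normc1; lra.
rewrite big_ord_recr /= mulrDr.
have [wn'|wn'] := leP (2^-1 ^+ n) (normc (1 - w)).
  apply: le_trans (IHn w1 wn') _.
  by rewrite lerDl mulr_ge0// pos.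
apply: le_trans (at_scale n.+1 w1 _) _.
  by rewrite wn /= exprS mulrA divff// mul1r ltW.
by rewrite lerDr mulr_ge0// sumr_ge0// => k _; exact: pos.
Qed.

Lemma Re_inv_1B w : w != 1 ->
  complex.Re (1 - w)^-1 - 2^-1 = (1 - normc w ^+ 2) / (2 * normc (1 - w) ^+ 2).
Proof.
move=> w1; have : 0 < normc (1 - w) ^+ 2.
  by rewrite exprn_gt0// normc_gt0 subr_eq0 eq_sym.
rewrite !normc_sqrE; case: w {w1} => x y /= => den.
by field; rewrite gt_eqF//; move: den; congr (_ < _); ring.
Qed.

Lemma pole_pair (c al : R) z : 0 < al -> z ^+ 2 != (al ^+ 2)%:C ->
  c / (2 * al) * complex.Re (al%:C - z)^-1
    + (- c / (2 * al)) * complex.Re ((- al)%:C - z)^-1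
  = c * complex.Re ((al ^+ 2)%:C - z ^+ 2)^-1.
Proof.
move=> al0 za; pose A := al%:C.
have A0 : A != 0 by rewrite fmorph_eq0 gt_eqF.
have w1 : A - z != 0.
  by apply: contra za; rewrite subr_eq0 => /eqP <-; rewrite -rmorphXn.
have w2 : A + z != 0.
  by apply: contra za; rewrite addrC addr_eq0 => /eqP ->; rewrite sqrrN -rmorphXn.
rewrite -!ReM_real -ReD; congr complex.Re.
have E : (c / (2 * al))%:C = c%:C / (2 * A).
  by rewrite fmorph_div rmorphM rmorph_nat.
rewrite mulNr rmorphN /= !rmorphN /= E rmorphXn /= -/A.
have -> : A ^+ 2 - z ^+ 2 = (A - z) * (A + z) by ring.
have -> : - A - z = - (A + z) by rewrite opprD.
by field; rewrite A0 w1 w2.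
Qed.

Lemma normc_1B_conjM z a : normc (1 - conjc a * z) ^+ 2 =
  normc (z - a) ^+ 2 + (1 - normc z ^+ 2) * (1 - normc a ^+ 2).
Proof. by rewrite !normc_sqrE; case: z => x y; case: a => u v /=; ring. Qed.

(** On the part of the boundary close to 1 or -1 the Blaschke factor of [a] has
    modulus smaller than one; the loss is compensated by a small multiple of the
    Poisson kernel [Re ((1 + w) / (1 - w))], [w = z ^ 2], which vanishes on the
    rest of the boundary. *)
Lemma blaschke_compensated (delta : R) z a : 0 < delta -> normc z <= 1 ->
  normc a < 1 -> 4 * delta <= normc (1 - a ^+ 2) -> z ^+ 2 != 1 ->
  normc z = 1 \/ normc (1 - z ^+ 2) = delta ->
  normc (1 - conjc a * z) <= normc (z - a) *
    expR (4 / 9 * (1 - normc a ^+ 2) * (complex.Re (1 - z ^+ 2)^-1 - 2^-1)).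
Proof.
move=> d0 z1 a1 ad zn1 []; rewrite Re_inv_1B// normcX.
  move=> zE; rewrite -[1](_ : (1 ^+ 2)%:C = 1); last by rewrite expr1n.
  rewrite (reflected_on_circle a zE) zE.
  by rewrite !expr1n subrr mul0r mulr0 expR0 mulr1 mul1r.
move=> zd; rewrite zd; set tau := 1 - normc a ^+ 2.
have tau0 : 0 < tau by rewrite subr_gt0 expr_lt1// normc_ge0.
have zz0 := normc_ge0 z; have aa0 := normc_ge0 a.
have z2 : 0 <= 1 - normc z ^+ 2 by rewrite subr_ge0 expr_le1.
have far : 3 / 2 * delta <= normc (z - a).
  have h1 : 3 * delta <= normc (z ^+ 2 - a ^+ 2).
    have -> : z ^+ 2 - a ^+ 2 = (1 - a ^+ 2) - (1 - z ^+ 2) by ring.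
    apply: le_trans (normc_subD _ _); rewrite normcN zd; lra.
  have h2 : normc (z ^+ 2 - a ^+ 2) <= normc (z - a) * 2.
    rewrite (_ : z ^+ 2 - a ^+ 2 = (z - a) * (z + a)); last by ring.
    rewrite normcM ler_wpM2l ?normc_ge0//.
    by apply: le_trans (le_normcD _ _) _; lra.
  lra.
rewrite -(ler_pXn2r (n := 2)) ?nnegrE ?mulr_ge0 ?normc_ge0 ?expR_ge0//.
rewrite normc_1B_conjM exprMn -expRM_natl.
set e := _ * (_ / _).
have e0 : tau * (1 - normc z ^+ 2) <= normc (z - a) ^+ 2 * (2 * e).
  have f2 : (3 / 2 * delta) ^+ 2 <= normc (z - a) ^+ 2.
    by rewrite lerXn2r ?nnegrE ?normc_ge0// mulr_ge0// ltW.
  have -> : 2 * e = 4 / 9 * tau * (1 - normc z ^+ 2 ^+ 2) / delta ^+ 2.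
    by rewrite /e; field; rewrite gt_eqF.
  rewrite mulrA ler_pdivlMr ?exprn_gt0//.
  have -> : 1 - normc z ^+ 2 ^+ 2 = (1 - normc z ^+ 2) * (1 + normc z ^+ 2) by ring.
  have t : 0 <= tau * (1 - normc z ^+ 2) by rewrite mulr_ge0// ltW.
  apply: (@le_trans _ _ ((3 / 2 * delta) ^+ 2 * (4 / 9 * tau * ((1 - normc z ^+ 2) * 1)))).
    by rewrite le_eqVlt; apply/orP; left; apply/eqP; field.
  apply: ler_pM => //; rewrite ?sqr_ge0//.
    by rewrite mulr1 -mulrA mulr_ge0// divr_ge0.
  rewrite ler_pM2l ?mulr_gt0 ?divr_gt0// ler_wpM2l// lerDl sqr_ge0//.
apply: (@le_trans _ _ (normc (z - a) ^+ 2 * (1 + 2 * e))).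
  by rewrite [X in _ <= X]mulrDr mulr1 lerD2l mulrC.
by rewrite ler_wpM2l ?sqr_ge0// expR_ge1Dx.
Qed.

Lemma prod_normc_le_exp s : (forall z, z \in s -> normc z < 1) ->
  \prod_(z <- s) normc z <= expR (- (\sum_(z <- s) (1 - normc z ^+ 2)) / 2).
Proof.
elim: s => [|z s IHs] s1; first by rewrite !big_nil oppr0 mul0r expR0.
have zs x : x \in s -> normc x < 1 by move=> xs; apply: s1; rewrite inE xs orbT.
rewrite !big_cons opprD mulrDl expRD ler_pM ?normc_ge0//; last exact: IHs.
  by apply: prodr_ge0 => *; exact: normc_ge0.
rewrite -(ler_pXn2r (n := 2)) ?nnegrE ?normc_ge0 ?expR_ge0// -expRM_natl.
apply: le_trans (expR_ge1Dx _); rewrite le_eqVlt; apply/orP; left; apply/eqP.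
by field.
Qed.

(** Each pole [a ^+ 2] in the variable [z ^+ 2] is a pair of poles at [a] and
    [- a] in the variable [z]. *)
Definition split_poles (l : seq (R * R)) : seq (R * R) :=
  flatten [seq [:: (e.1 / (2 * e.2), e.2); (- e.1 / (2 * e.2), - e.2)] | e <- l].

Lemma sum_split_poles (l : seq (R * R)) z :
  (forall e, e \in l -> 0 < e.2) -> (forall e, e \in l -> z ^+ 2 != (e.2 ^+ 2)%:C) ->
  \sum_(e <- split_poles l) e.1 * complex.Re (e.2%:C - z)^-1
  = \sum_(e <- l) e.1 * complex.Re ((e.2 ^+ 2)%:C - z ^+ 2)^-1.
Proof.
elim: l => [|e l IHl] l0 lz; first by rewrite !big_nil.
rewrite /split_poles /= !big_cons -/(split_poles l) IHl => [|e' e'l|e' e'l];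
  [|by apply: l0; rewrite inE e'l orbT|by apply: lz; rewrite inE e'l orbT].
by rewrite addrA pole_pair ?l0 ?lz ?mem_head.
Qed.

Lemma mem_split_poles (l : seq (R * R)) e : e \in split_poles l ->
  exists2 e', e' \in l & e.2 ^+ 2 = e'.2 ^+ 2.
Proof.
case/flatten_mapP => e' e'l; rewrite !inE => /orP[]/eqP -> /=; exists e' => //.
by rewrite sqrrN.
Qed.

(** Jensen's inequality for the region [2 ^- n <= normc (1 - z ^+ 2)] of the unit
    disc.  The maximum principle is applied to the polynomial divided by its
    compensated Blaschke product and by the exponential of the harmonic majorant
    of the growth exponent.  As the majorant is at most a multiple of [n.+1] at 0,
    passing from the region to the whole disc costs only a factor [n.+1]. *)
Lemma zeros_away_from_edges K s n : 0 <= K -> zeros_with_growth K s ->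
  (forall z, z \in s -> normc z < 1) ->
  (forall z, z \in s -> 4 * 2^-1 ^+ n <= normc (1 - z ^+ 2)) ->
  \sum_(z <- s) (1 - normc z ^+ 2) <= 22 * K * n.+1%:R.
Proof.
move=> K0 sK s1 sn; set T := \sum_(z <- s) _.
pose delta : R := 2^-1 ^+ n.
have d0 : 0 < delta by rewrite exprn_gt0// invr_gt0.
have d1 : delta <= 1 by rewrite exprn_ile1// ?invr_ge0// invf_le1// ler1n.
pose al k : R := 1 + 2^-1 ^+ k.
have al1 k : 1 < al k by rewrite ltrDl exprn_gt0// invr_gt0.
(* The first entry collects the Poisson kernels of [blaschke_compensated] for all
   zeros, the others are the majorant of [harmonic_majorant]. *)
pose l0 := (- (4 / 9 * T), 1) :: [seq (- (6 * K), al k) | k <- iota 0 n.+1].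
have l0_ge1 e : e \in l0 -> 1 <= e.2.
  by rewrite inE => /orP[/eqP ->//|/mapP[k _ ->]]; exact/ltW/al1.
pose H z := \sum_(k < n.+1) complex.Re ((al k ^+ 2)%:C - z ^+ 2)^-1.
have regular z e : normc z <= 1 -> z ^+ 2 != 1 -> e \in l0 -> z ^+ 2 != (e.2 ^+ 2)%:C.
  move=> z1 zn1; rewrite inE => /orP[/eqP ->|/mapP[k _ ->]] /=.
    by rewrite expr1n.
  apply/negP => /eqP zE; have : normc (z ^+ 2) <= 1.
    by rewrite normcX exprn_ile1// normc_ge0.
  rewrite zE normc_real ger0_norm ?sqr_ge0// leNgt => /negP; apply.
  by rewrite exprn_egt1.
have lE z : normc z <= 1 -> z ^+ 2 != 1 ->
   \sum_(e <- split_poles l0) e.1 * complex.Re (e.2%:C - z)^-1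
   = - (4 / 9 * T) * complex.Re (1 - z ^+ 2)^-1 - 6 * K * H z.
  move=> z1 zn1; rewrite sum_split_poles => [|e /l0_ge1|e]; last exact: regular.
    rewrite big_cons big_map expr1n; congr (_ + _).
    rewrite /H -(big_mkord xpredT (fun k => complex.Re ((al k ^+ 2)%:C - z ^+ 2)^-1)).
    by rewrite -[in RHS]mulNr big_distrr /= /index_iota subn0.
  exact: lt_le_trans.
suff main d : 0 < d -> 1 - d <= (1 + d) * expR (6 * K * n.+1%:R - 5 / 18 * T).
  have : 1 <= expR (6 * K * n.+1%:R - 5 / 18 * T).
    move: main; set E := expR _ => main; rewrite leNgt; apply/negP => E1.
    have E0 : 0 <= E by exact: expR_ge0.
    have := main ((1 - E) / 4); rewrite divr_gt0 ?subr_gt0// => /(_ isT) H1.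
    have : 0 < (1 - E) * (3 - E) by rewrite mulr_gt0// subr_gt0//; lra.
    by nra.
  have Kn : 0 <= K * n.+1%:R by rewrite mulr_ge0.
  rewrite -[leLHS]expR0 ler_expR -!mulrA => ?; lra.
move=> dd0; have [g g1 g2] := sK d dd0.
pose p := g * reflected_prod 1 s.
(* The constant term [1 / 2] of the Poisson kernels is moved to the bound. *)
pose m := (1 + d) * expR (- (2 / 9 * T)).
have m0 : 0 < m by rewrite mulr_gt0 ?expR_gt0// addr_gt0.
have : harmonic_weight p (split_poles l0) 0 <= m.
  have zn1 z : truncated_disc 1 delta z -> z ^+ 2 != 1.
    move=> [_ zd]; rewrite eq_sym -subr_eq0 -normc_eq0 gt_eqF//.
    exact: lt_le_trans zd.
  apply: (@harmonic_weight_le _ _ _ 1 delta) => //; first by rewrite ler01 lexx.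
    move=> e z /mem_split_poles[e' e'l E] zX; have [z1 _] := zX.
    have := regular z e' z1 (zn1 _ zX) e'l; apply: contra => /eqP ->.
    by rewrite -E rmorphXn.
  move=> z zX zb; have [z1 zd] := zX.
  rewrite harmonic_weightE lE ?zn1//.
  rewrite hornerM normcM.
  have fz := g1 z z1 (zn1 _ zX).
  have Hz : K * normc z / normc (1 - z ^+ 2) <= 6 * K * H z.
    have z21 : normc (z ^+ 2) <= 1 by rewrite normcX exprn_ile1// normc_ge0.
    rewrite (mulrC 6) -!mulrA; apply: (@le_trans _ _ (K * (normc (1 - z ^+ 2))^-1)).
      by rewrite ler_wpM2l// ler_piMl// invr_ge0 normc_ge0.
    by rewrite ler_wpM2l// (harmonic_majorant z21 zd).
  have refl : normc (reflected_prod 1 s).[z] <= normc (root_prod s).[z] *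
      expR (4 / 9 * T * (complex.Re (1 - z ^+ 2)^-1 - 2^-1)).
    have -> : expR (4 / 9 * T * (complex.Re (1 - z ^+ 2)^-1 - 2^-1)) = \prod_(a <- s)
        expR (4 / 9 * (1 - normc a ^+ 2) * (complex.Re (1 - z ^+ 2)^-1 - 2^-1)).
      by rewrite -expR_sum -big_distrl -big_distrr.
    rewrite normc_reflected_prod normc_root_prod -big_split /= big_seq [leRHS]big_seq.
    apply: ler_prod => a sa; rewrite normc_ge0 expr1n.
    apply: (blaschke_compensated d0 z1 (s1 a sa) (sn a sa) (zn1 _ zX)).
    exact: zb.
  set P := complex.Re (1 - z ^+ 2)^-1 in refl *.
  apply: (@le_trans _ _ (normc (root_prod s * g).[z] *
     expR (- (6 * K * H z) - 2 / 9 * T))).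
    have -> : - (6 * K * H z) - 2 / 9 * T =
       4 / 9 * T * (P - 2^-1) + (- (4 / 9 * T) * P - 6 * K * H z) by field.
    rewrite [X in _ <= _ * X]expRD mulrA ler_wpM2r ?expR_ge0// hornerM normcM.
    by rewrite mulrC mulrAC ler_wpM2r ?normc_ge0.
  rewrite expRD mulrA ler_wpM2r ?expR_ge0//.
  apply: (@le_trans _ _ ((expR (6 * K * H z) + d) * expR (- (6 * K * H z)))).
    rewrite ler_wpM2r ?expR_ge0//; apply: le_trans fz _.
    by rewrite lerD2r ler_expR.
  rewrite mulrDl -expRD subrr expR0 lerD2l ler_piMr ?(ltW dd0)//.
  rewrite -[leRHS]expR0 ler_expR oppr_le0; apply: le_trans Hz.
  by rewrite mulr_ge0 ?invr_ge0 ?normc_ge0// mulr_ge0 ?normc_ge0.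
rewrite harmonic_weightE lE ?normc0// ?expr0n 1?eq_sym ?oner_neq0//.
rewrite hornerM normcM reflected_prod0 expr1n mulr1 subr0 invr1 mulr1 => g0.
have H0 : H 0 <= n.+1%:R.
  rewrite -[X in _ <= X%:R]card_ord -sumr_const; apply: ler_sum => k _.
  rewrite expr0n subr0 -fmorphV /= invf_le1 ?exprn_gt0 ?(lt_trans ltr01)//.
  by rewrite exprn_ege1// ltW.
apply: le_trans g2 _; rewrite hornerM normcM normc_root_prod.
have := prod_normc_le_exp s1.
under eq_bigr do rewrite -normcN -sub0r.
rewrite -/T => QT.
apply: (@le_trans _ _ (expR (- T / 2) * (m * expR (4 / 9 * T + 6 * K * H 0)))).
  apply: ler_pM; rewrite ?normc_ge0//.
    by apply: prodr_ge0 => *; exact: normc_ge0.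
  rewrite -ler_pdivrMr ?expR_gt0// -expRN; apply: le_trans g0.
  by rewrite le_eqVlt; apply/orP; left; apply/eqP; congr (_ * expR _); ring.
have -> x y : x * (m * y) = (1 + d) * (x * expR (- (2 / 9 * T)) * y).
  by rewrite /m; ring.
rewrite ler_wpM2l ?addr_ge0 ?(ltW dd0)//.
rewrite -!expRD ler_expR.
have : K * H 0 <= K * n.+1%:R by rewrite ler_wpM2l.
by rewrite -!mulrA => ?; lra.
Qed.

End ZeroCounting.

(** * Summation over dyadic scales *)

Section DyadicSums.
Context {R : realType}.
Implicit Types (z w : R[i]) (s : seq R[i]) (K q : R).

(** Each term is charged to one of the scales [n] at which the corresponding sum
    of [v] is under control. *)
Lemma sum_by_scales s (P : nat -> pred R[i]) (w v : R[i] -> R) (c A : nat -> R) (B : R) :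
  (forall n, 0 <= c n) -> (forall z, z \in s -> 0 <= v z) ->
  (forall z, z \in s -> exists2 n, P n z & w z <= c n * v z) ->
  (forall n, \sum_(z <- s | P n z) v z <= A n) ->
  (forall N, \sum_(n < N) c n * A n <= B) ->
  \sum_(z <- s) w z <= B.
Proof.
move=> c0 v0 cover Pv AB.
have [N NP] : exists N, forall z, z \in s -> exists n, [/\ (n < N)%N, P n z & w z <= c n * v z].
  elim: s v0 cover {Pv} => [|z s IHs] v0 cover; first by exists 0%N.
  have [N NP] : exists N, forall z, z \in s -> exists n, [/\ (n < N)%N, P n z & w z <= c n * v z].
    by apply: IHs => x xs; [apply: v0|apply: cover]; rewrite inE xs orbT.
  have [n Pn wn] := cover z (mem_head _ _); exists (maxn N n.+1) => x.
  rewrite inE => /orP[/eqP ->|/NP[k [kN Pk wk]]].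
    by exists n; split => //; rewrite leq_max ltnSn orbT.
  by exists k; split => //; rewrite leq_max kN.
apply: le_trans (AB N).
apply: (@le_trans _ _ (\sum_(z <- s) \sum_(n < N) (if P n z then c n * v z else 0))).
  rewrite big_seq [leRHS]big_seq; apply: ler_sum => z zs.
  have [n [nN Pn wn]] := NP z zs.
  rewrite (bigD1 (Ordinal nN))//= Pn; apply: le_trans wn _; rewrite lerDl.
  by apply: sumr_ge0 => i _; case: ifP => // _; rewrite mulr_ge0// v0.
rewrite exchange_big /=; apply: ler_sum => n _.
by rewrite -big_mkcond -big_distrr /= ler_wpM2l.
Qed.

Lemma dyadic_scale (x : R) : 0 < x <= 1 -> exists n, 2^-1 ^+ n.+1 < x <= 2^-1 ^+ n.
Proof.
move=> /andP[x0 x1].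
have ex : exists n, 2^-1 ^+ n.+1 < x.
  exists (Num.bound x^-1); rewrite exprVn invf_plt ?posrE ?exprn_gt0//.
  apply: lt_trans (archi_boundP _) _; first by rewrite invr_ge0 ltW.
  by rewrite -natrX ltr_nat (leq_trans (ltnSn _))// ltnW// ltn_expl.
exists (ex_minn ex); case: ex_minnP => -[|n] -> nmin /=; first by rewrite expr0.
rewrite leNgt; apply/negP => xn.
by have := nmin n xn; rewrite ltnn.
Qed.

Lemma sum_geom_le q N : 0 <= q < 1 -> \sum_(n < N) q ^+ n <= (1 - q)^-1.
Proof.
move=> /andP[q0 q1]; rewrite -[leRHS]mulr1 ler_pdivlMl ?subr_gt0//.
by rewrite -opprB mulNr -subrX1 opprB lerBlDr lerDl exprn_ge0.
Qed.

Lemma sum_arith_geom_le q N : 0 <= q < 1 ->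
  \sum_(n < N) n.+1%:R * q ^+ n <= (1 - q)^-1 ^+ 2.
Proof.
move=> /andP[q0 q1]; have q1' : 0 < 1 - q by rewrite subr_gt0.
have E : (1 - q) * \sum_(n < N) n.+1%:R * q ^+ n =
    \sum_(n < N) q ^+ n - N%:R * q ^+ N.
  elim: N => [|N IHN]; first by rewrite !big_ord0 mul0r subrr mulr0.
  rewrite !big_ord_recr /= mulrDr IHN exprS -natr1; ring.
rewrite expr2 ler_pdivlMl// E.
apply: le_trans (sum_geom_le N _); last by rewrite q0.
by rewrite lerBlDr lerDl mulr_ge0 ?exprn_ge0.
Qed.

Lemma powR_exprn (x eps : R) n : 0 <= x -> (x ^+ n) `^ eps = (x `^ eps) ^+ n.
Proof.
move=> x0; elim: n => [|n IHn]; first by rewrite !expr0 powR1.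
by rewrite !exprS powRM ?exprn_ge0// IHn.
Qed.

Lemma powR2_bounds (eps : R) : 0 < eps < 1 -> 1 < 2 `^ eps < 2.
Proof.
move=> /andP[e0 e1]; have l2 : 0 < ln (2 : R) by rewrite ln_gt0// ltr1n.
rewrite /powR gt_eqF//; apply/andP; split.
  by rewrite -[ltLHS]expR0 ltr_expR mulr_gt0.
by rewrite -[ltRHS]lnK ?posrE// ltr_expR gtr_pMl.
Qed.

(** Up to a constant, the contribution of the eigenvalue [z + z^-1]: the distance
    of [z + z^-1] to the segment is comparable to [1 - normc z] times
    [normc (1 - z ^+ 2) / normc z], and the latter is the square root of
    [normc ((z + z^-1) ^+ 2 - 4)]. *)
Definition zero_weight (eps : R) z : R :=
  (1 - normc z) * (normc (1 - z ^+ 2) / normc z) `^ eps.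

Lemma normc_1Bsqr_le2 z : normc z <= 1 -> normc (1 - z ^+ 2) <= 2.
Proof.
move=> z1; apply: le_trans (le_normcD _ _) _; rewrite normcN normc1 normcX.
by rewrite -[2]/(1 + 1) lerD2l exprn_ile1// normc_ge0.
Qed.

(** On the scale [normc z ~ 2 ^- n] there are at most a multiple of [2 ^- n] zeros,
    each of weight at most a multiple of [2 `^ (n * eps)]: this is where
    [eps < 1] is needed. *)
Lemma sum_zero_weight_near_origin (eps : R) K s : 0 < eps < 1 -> 0 <= K ->
  zeros_with_growth K s -> (forall z, z \in s -> 0 < normc z < 4^-1) ->
  \sum_(z <- s) zero_weight eps z <= 22 * (1 - 2 `^ eps / 2)^-1 * K.
Proof.
move=> e01 K0 sK s1; have /andP[e0 e1] := e01.
have := powR2_bounds e01; set q := 2 `^ eps => /andP[q1 q2].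
have q0 : 0 <= q := powR_ge0 _ _.
pose P n z := 2^-1 ^+ n.+1 < 4 * normc z <= 2^-1 ^+ n.
pose A n := 8 / 3 * K * 2^-1 ^+ n.+1.
apply: (@sum_by_scales s P _ (fun=> 1) (fun n => q ^+ (n + 4)) A) => //.
- by move=> n; rewrite exprn_ge0.
- move=> z zs; have /andP[z0 z4] := s1 z zs.
  have [|n zn] := @dyadic_scale (4 * normc z).
    by rewrite mulr_gt0//= -ler_pdivlMl// mulr1 ltW.
  exists n => //; rewrite mulr1 /zero_weight.
  rewrite -[leRHS]mul1r ler_pM ?powR_ge0 ?subr_ge0//; last 2 first.
  + by rewrite lerBlDr lerDl ltW.
  + rewrite -powR_exprn// ge0_ler_powR ?nnegrE ?exprn_ge0 ?divr_ge0 ?normc_ge0 ?(ltW e0)//.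
    rewrite ler_pdivrMr//.
    have /andP[zn1 _] := zn.
    have zn1' : normc (1 - z ^+ 2) <= 2 by apply: normc_1Bsqr_le2; lra.
    have : 2 ^+ n.+1 * 2^-1 ^+ n.+1 < 2 ^+ n.+1 * (4 * normc z).
      by rewrite ltr_pM2l// exprn_gt0.
    rewrite -exprMn divff// expr1n => h.
    have -> : 2 ^+ (n + 4) * normc z = 2 * (2 ^+ n.+1 * (4 * normc z)).
      by rewrite exprD [2 ^+ n.+1]exprS; ring.
    lra.
  + by lra.
- move=> n; rewrite -big_filter big_const_seq count_predT.
  set t := [seq _ <- _ | _]; pose rho : R := 2^-1 ^+ n.+1.
  have rho0 : 0 < rho by rewrite exprn_gt0// invr_gt0.
  have rho1 : rho <= 2^-1.
    by rewrite /rho exprS ler_piMr ?invr_ge0// exprn_ile1// ?invr_ge0// invf_le1// ler1n.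
  have -> : iter (size t) (+%R 1) 0 = (size t)%:R :> R by rewrite -Monoid.iteropE.
  have := @zeros_near_origin R K t rho _ K0 (zeros_with_growth_filter _ sK).
  have -> : 0 < rho < 1 by rewrite rho0 (le_lt_trans rho1)// invf_lt1// ltr1n.
  move=> /(_ isT) H.
  have {H} : (size t)%:R / 2 <= K * rho / (1 - rho ^+ 2).
    apply: H => z; rewrite mem_filter => /andP[/andP[_ zn] _].
    by rewrite /rho exprS; lra.
  have : K * rho / (1 - rho ^+ 2) <= 4 / 3 * (K * rho).
    have K1 : 0 <= K * rho by rewrite mulr_ge0// ltW.
    have r4 : rho ^+ 2 <= 4^-1.
      have -> : 4^-1 = (2^-1 : R) ^+ 2 by field.
      by rewrite lerXn2r ?nnegrE ?invr_ge0// ltW.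
    move: (K * rho) (rho ^+ 2) K1 r4 => x r x0 r4.
    by rewrite ler_pdivrMr; [nra|lra].
  by rewrite /A -/rho; lra.
move=> N; rewrite -mulrA [_ * K]mulrC mulrA.
have : \sum_(n < N) (q / 2) ^+ n <= (1 - q / 2)^-1.
  by apply: sum_geom_le; rewrite divr_ge0//= ltr_pdivrMr// mul1r.
set S := \sum_(n < N) _; set I := _^-1 => SI.
have -> : \sum_(n < N) q ^+ (n + 4) * A n = 4 / 3 * q ^+ 4 * K * S.
  rewrite big_distrr /=; apply: eq_bigr => n _.
  by rewrite /A exprD exprMn [2^-1 ^+ n.+1]exprS; field.
have S0 : 0 <= S by apply: sumr_ge0 => n _; rewrite exprn_ge0// divr_ge0.
have q4 : q ^+ 4 <= 2 ^+ 4 by rewrite lerXn2r ?nnegrE ?(ltW q2).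
apply: ler_pM => //; first by rewrite !mulr_ge0 ?invr_ge0 ?exprn_ge0.
by rewrite ler_wpM2r//; lra.
Qed.

(** On the scale [normc (1 - z ^+ 2) ~ 2 ^- n] the weight gains a factor
    [2 `^ (- n * eps)] over [1 - normc z ^+ 2], which beats the loss [n.+1]: this
    is where [0 < eps] is needed. *)
Lemma sum_zero_weight_away (eps : R) K s : 0 < eps < 1 -> 0 <= K ->
  zeros_with_growth K s -> (forall z, z \in s -> 4^-1 <= normc z < 1) ->
  \sum_(z <- s) zero_weight eps z <= 704 * (1 - (2 `^ eps)^-1)^-1 ^+ 2 * K.
Proof.
move=> e01 K0 sK s1; have /andP[e0 e1] := e01.
have := powR2_bounds e01; set q := (2 `^ eps)^-1 => /andP[q1 q2].
have q0 : 0 <= q by rewrite invr_ge0 powR_ge0.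
have q1' : q < 1 by rewrite invf_lt1// (lt_trans ltr01).
pose P n z := 4 * 2^-1 ^+ n.+1 <= normc (1 - z ^+ 2) <= 4 * 2^-1 ^+ n.
pose A n := 22 * K * n.+2%:R.
apply: (@sum_by_scales s P _ (fun z => 1 - normc z ^+ 2) (fun n => 16 * q ^+ n) A) => //.
- by move=> n; rewrite mulr_ge0// exprn_ge0.
- move=> z /s1/andP[_ z1].
  by rewrite subr_ge0 exprn_ile1 ?normc_ge0// ltW.
- move=> z zs; have /andP[z4 z1] := s1 z zs.
  have z0 : 0 < normc z by lra.
  have zn1 : 0 < normc (1 - z ^+ 2).
    rewrite normc_gt0 subr_eq0 eq_sym; apply/negP => /eqP zE.
    have : normc (z ^+ 2) < 1 by rewrite normcX expr_lt1// ltW.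
    by rewrite zE normc1 ltxx.
  have zn2 := normc_1Bsqr_le2 (ltW z1).
  have [|n /andP[nz zn]] := @dyadic_scale (normc (1 - z ^+ 2) / 4).
    by rewrite divr_gt0//= ler_pdivrMr// mul1r; lra.
  exists n; first by rewrite /P; lra.
  rewrite /zero_weight mulrC ler_pM ?powR_ge0 ?subr_ge0 ?(ltW z1)//; last first.
    by rewrite lerD2l lerN2 expr2 ler_piMr ?normc_ge0// ltW.
  have -> : q ^+ n = (2^-1 ^+ n) `^ eps.
    by rewrite powR_exprn ?invr_ge0// /q -powR_inv1// powRAC powR_inv1 ?powR_ge0.
  apply: (@le_trans _ _ ((16 * 2^-1 ^+ n) `^ eps)).
    rewrite ge0_ler_powR ?nnegrE ?mulr_ge0 ?exprn_ge0 ?invr_ge0 ?normc_ge0 ?(ltW e0)//.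
    rewrite ler_pdivrMr//.
    have p0 : 0 < 2^-1 ^+ n :> R by rewrite exprn_gt0// invr_gt0.
    nra.
  rewrite powRM ?exprn_ge0 ?invr_ge0// ler_wpM2r ?powR_ge0//.
  by rewrite ler1_powR ?ler1n// ltW.
- move=> n; rewrite -big_filter.
  apply: zeros_away_from_edges => // [|z|z]; first exact: zeros_with_growth_filter.
    by rewrite mem_filter => /andP[_ /s1/andP[]].
  by rewrite mem_filter => /andP[/andP[]].
move=> N.
have := sum_arith_geom_le N (_ : 0 <= q < 1); rewrite q0 q1' => /(_ isT).
set I := _ ^-1 ^+ 2 => SI.
apply: (@le_trans _ _ (704 * K * (\sum_(n < N) n.+1%:R * q ^+ n))); last first.
  by rewrite [leRHS]mulrAC ler_wpM2l ?mulr_ge0 ?ler0n.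
rewrite big_distrr; apply: ler_sum => n _ /=.
have -> : 16 * q ^+ n * A n = 352 * K * (n.+2%:R * q ^+ n) by rewrite /A; ring.
have qn : 0 <= q ^+ n by rewrite exprn_ge0.
have : n.+2%:R * q ^+ n <= 2 * (n.+1%:R * q ^+ n).
  by rewrite mulrA ler_wpM2r// -natrM ler_nat mul2n -addnn -[n.+2]addn1 leq_add2l.
move=> H; rewrite (_ : 704 * K * _ = 352 * K * (2 * (n.+1%:R * q ^+ n))); last by ring.
by rewrite ler_wpM2l ?mulr_ge0 ?ler0n.
Qed.

Definition zero_weight_constant (eps : R) : R :=
  22 * (1 - 2 `^ eps / 2)^-1 + 704 * (1 - (2 `^ eps)^-1)^-1 ^+ 2.

Lemma zero_weight_constant_gt0 (eps : R) : 0 < eps < 1 -> 0 < zero_weight_constant eps.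
Proof.
move=> /powR2_bounds/andP[q1 q2]; apply: addr_gt0; apply: mulr_gt0.
- by rewrite ltr0n.
- by rewrite invr_gt0 subr_gt0 ltr_pdivrMr// mul1r.
- by rewrite ltr0n.
- by rewrite exprn_gt0// invr_gt0 subr_gt0 invf_lt1// (lt_trans ltr01).
Qed.

Lemma sum_zero_weight (eps : R) K s : 0 < eps < 1 -> 0 <= K ->
  zeros_with_growth K s -> (forall z, z \in s -> 0 < normc z < 1) ->
  \sum_(z <- s) zero_weight eps z <= zero_weight_constant eps * K.
Proof.
move=> e01 K0 sK s1; rewrite (bigID (fun z => normc z < 4^-1)) /= mulrDl.
apply: lerD; rewrite -big_filter.
  apply: sum_zero_weight_near_origin => //; first exact: zeros_with_growth_filter.
  by move=> z; rewrite mem_filter => /andP[-> /s1/andP[->]].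
apply: sum_zero_weight_away => //; first exact: zeros_with_growth_filter.
by move=> z; rewrite mem_filter -leNgt => /andP[-> /s1/andP[_ ->]].
Qed.

End DyadicSums.

(** * The Jost polynomials and their growth *)

Section JostPolynomials.
Context {R : realType}.
Variables (b w : nat -> R[i]).
Implicit Types (x : R[i]) (n : nat).

Let hE := (hornerD, hornerN, hornerM, hornerC, hornerX, hornerXn).

(** [(P n, P n.-1)] where [P n] is [X ^ n] times the characteristic polynomial,
    at [X + X^-1], of the leading block of size [n] of a Jacobi matrix with
    diagonal [b] and products of opposite off-diagonal entries [w]. *)
Fixpoint truncations n : {poly R[i]} * {poly R[i]} :=
  if n is n'.+1 then
    let p := truncations n' in
    ((1 + 'X ^+ 2 - (b n')%:P * 'X) * p.1 - (w n'.-1)%:P * 'X ^+ 2 * p.2, p.1)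
  else (1, 0).

(** Up to a power of [X], the Wronskian of the polynomial solution with the free
    solution [X ^ n]: the Jost function of the Jacobi matrix whose entries are
    replaced by the free ones beyond the block of size [n]. *)
Definition jost n : {poly R[i]} := (truncations n).1 - 'X ^+ 2 * (truncations n).2.

(** The Wronskian with the other free solution [X ^- n]. *)
Definition jost2 n : {poly R[i]} := (truncations n).1 - (truncations n).2.

Definition coef_dist n : R := normc (b n) + normc (1 - w n).

Lemma jost_at0 n : (jost n).[0] = 1.
Proof.
have P0 : (truncations n).1.[0] = 1.
  by elim: n => [|n IHn] /=; rewrite !hE// IHn; ring.
by rewrite /jost !hE P0; ring.
Qed.

(** Variation of constants: both Wronskians change from [n] to [n.+1] by the
    deviation of the coefficients times [P n] and [P n.-1], and these are in turn
    combinations of the two Wronskians divided by [1 - X ^ 2]. *)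
Lemma jost_growth n x : normc x <= 1 -> x ^+ 2 != 1 ->
  normc (jost n).[x] <=
    expR (2 * (\sum_(0 <= k < n) coef_dist k) * normc x / normc (1 - x ^+ 2)).
Proof.
move=> x1 xn1; set r := normc (1 - x ^+ 2).
have r0 : 0 < r by rewrite normc_gt0 subr_eq0 eq_sym.
(* The product [w k] enters one step later than [b k]. *)
pose s n := \sum_(0 <= k < n) (normc (b k) + if k is m.+1 then normc (1 - w m) else 0).
pose E n := expR (2 * s n * normc x / r).
have sle m : s m <= \sum_(0 <= k < m) coef_dist k.
  rewrite /s /coef_dist !big_split /= lerD2l.
  case: m => [|m]; first by rewrite !big_geq.
  rewrite big_nat_recl//= add0r big_nat_recr//= lerDl; exact: normc_ge0.
suff [H _] : normc (jost n).[x] <= E n /\ normc (jost2 n).[x] <= E n.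
  apply: le_trans H _; rewrite ler_expR -!mulrA ler_wpM2l// ler_wpM2r//.
  by rewrite mulr_ge0 ?normc_ge0// invr_ge0 ltW.
elim: n => [|n [IH1 IH2]].
  have -> : E 0%N = 1 by rewrite /E /s big_geq// mulr0 !mul0r expR0.
  by rewrite /jost /jost2 /= mulr0 subr0 hornerC normc1.
set P := (truncations n).1.[x]; set P' := (truncations n).2.[x].
have WE : (jost n).[x] = P - x ^+ 2 * P' by rewrite /jost !hE.
have VE : (jost2 n).[x] = P - P' by rewrite /jost2 !hE.
have bound Q : (1 - x ^+ 2) * Q = (jost n).[x] - x ^+ 2 * (jost2 n).[x] \/
   (1 - x ^+ 2) * Q = (jost n).[x] - (jost2 n).[x] -> normc Q <= 2 * E n / r.
  move=> QE; rewrite ler_pdivlMr// mulrC -normcM.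
  case: QE => ->; apply: le_trans (le_normcD _ _) _; rewrite normcN.
    rewrite normcM normcX.
    have : normc x ^+ 2 * normc (jost2 n).[x] <= normc (jost2 n).[x].
      by rewrite ler_piMl ?normc_ge0// exprn_ile1// normc_ge0.
    by lra.
  by lra.
have PB : normc P <= 2 * E n / r by apply: bound; left; rewrite WE VE; ring.
have PB' : normc P' <= 2 * E n / r by apply: bound; right; rewrite WE VE; ring.
pose D := - b n * P + x * (1 - w n.-1) * P'.
have DB : normc D <= (normc (b n) + if n is m.+1 then normc (1 - w m) else 0) * (2 * E n / r).
  apply: le_trans (le_normcD _ _) _; rewrite mulrDl lerD//.
    rewrite normcM normcN. by apply: ler_wpM2l; rewrite // normc_ge0.
  case: n @P @P' @D {IH1 IH2 WE VE bound PB} PB' => [|m] P P' D PB' /=.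
    by rewrite /P' /= horner0 mulr0 normc0 mul0r.
  rewrite !normcM ler_pM ?mulr_ge0 ?normc_ge0//.
  by rewrite ler_piMl ?normc_ge0.
have En : E n + normc x * normc D <= E n.+1.
  set e := normc (b n) + _ in DB *.
  have -> : E n.+1 = E n * expR (2 * e * normc x / r).
    rewrite /E -expRD; congr expR.
    by rewrite {1}/s big_nat_recr//= -/(s n) -/e; ring.
  apply: (@le_trans _ _ (E n * (1 + 2 * e * normc x / r))); last first.
    by rewrite ler_wpM2l ?expR_ge0// expR_ge1Dx.
  rewrite mulrDr mulr1 lerD2l.
  apply: (@le_trans _ _ (normc x * (e * (2 * E n / r)))).
    by rewrite ler_wpM2l ?normc_ge0.
  by rewrite le_eqVlt; apply/orP; left; apply/eqP; field; rewrite gt_eqF.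
have W' : (jost n.+1).[x] = (jost n).[x] + x * D.
  by rewrite WE /jost /= !hE -/P -/P' /D; ring.
have V' : (jost2 n.+1).[x] = x ^+ 2 * (jost2 n).[x] + x * D.
  by rewrite VE /jost2 /= !hE -/P -/P' /D; ring.
split; apply: le_trans En.
  by rewrite W'; apply: le_trans (le_normcD _ _) _; rewrite normcM lerD2r.
rewrite V'; apply: le_trans (le_normcD _ _) _; rewrite [normc (x ^+ 2 * _)]normcM normcX [normc (x * _)]normcM lerD2r.
by apply: le_trans IH2; rewrite ler_piMl ?normc_ge0// exprn_ile1// normc_ge0.
Qed.

End JostPolynomials.

(** * Sequences of polynomials that vanish modulo a polynomial *)

Section VanishingModulo.
Context {R : realType}.
Implicit Types (z x : R[i]) (D p q : {poly R[i]}) (H W : nat -> {poly R[i]}).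

Definition bounded_on_disc H := exists B : R,
  forall n x, normc x <= 1 -> normc (H n).[x] <= B.

Definition vanishing H := forall d : R, 0 < d ->
  \forall n \near \oo, forall x, normc x <= 1 -> normc (H n).[x] <= d.

(** In the limit [W] becomes a multiple of [D]: the values and the derivatives
    prescribed by the multiple roots of [D] tend to zero. *)
Definition vanishing_mod D W := exists2 H, vanishing H & forall n, D %| W n - H n.

Lemma bounded_poly p : bounded_on_disc (fun=> p).
Proof.
elim/poly_ind: p => [|p c [B HB]].
  by exists 0 => n x _; rewrite horner0 normc0.
exists (B + normc c) => n x x1; rewrite hornerMXaddC.
apply: le_trans (le_normcD _ _) _; rewrite lerD2r normcM.
have B0 : 0 <= B by apply: le_trans (HB n x x1); exact: normc_ge0.
by rewrite -[leRHS]mulr1 ler_pM ?normc_ge0// HB.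
Qed.

Lemma bounded_on_discM H1 H2 : bounded_on_disc H1 -> bounded_on_disc H2 ->
  bounded_on_disc (fun n => H1 n * H2 n).
Proof.
move=> [A HA] [B HB]; exists (A * B) => n x x1.
by rewrite hornerM normcM ler_pM ?normc_ge0 ?HA ?HB.
Qed.

Lemma bounded_on_disc_sum m (H : 'I_m -> nat -> {poly R[i]}) :
  (forall i, bounded_on_disc (H i)) -> bounded_on_disc (fun n => \sum_i H i n).
Proof.
move=> HB; have {}HB i : {B : R | forall n x, normc x <= 1 -> normc (H i n).[x] <= B}.
  exact/cid/HB.
exists (\sum_i sval (HB i)) => n x x1; rewrite horner_sum.
apply: le_trans (normc_sum _ _) _; apply: ler_sum => i _.
by case: (HB i) => B /= ->.
Qed.

Lemma vanishingM H1 H2 : vanishing H1 -> bounded_on_disc H2 ->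
  vanishing (fun n => H1 n * H2 n).
Proof.
move=> V1 [B HB] d d0; near=> n => x x1.
have h1 : forall x, normc x <= 1 -> normc (H1 n).[x] <= d / (`|B| + 1).
  by near: n; apply: V1; rewrite divr_gt0// ltr_wpDl.
rewrite hornerM normcM; apply: (@le_trans _ _ (d / (`|B| + 1) * (`|B| + 1))).
  rewrite ler_pM ?normc_ge0 ?h1//; apply: le_trans (HB n x x1) _.
  by apply: le_trans (ler_norm _) _; rewrite lerDl.
by rewrite divfK// gt_eqF// ltr_wpDl.
Unshelve. all: by end_near. Qed.

Lemma vanishingD H1 H2 : vanishing H1 -> vanishing H2 ->
  vanishing (fun n => H1 n + H2 n).
Proof.
move=> V1 V2 d d0; have d2 : 0 < d / 2 by rewrite divr_gt0.
near=> n => x x1.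
have h1 : forall x, normc x <= 1 -> normc (H1 n).[x] <= d / 2.
  by near: n; exact: V1.
have h2 : forall x, normc x <= 1 -> normc (H2 n).[x] <= d / 2.
  by near: n; exact: V2.
rewrite hornerD; apply: le_trans (le_normcD _ _) _.
by rewrite [leRHS](splitr d) lerD ?h1 ?h2.
Unshelve. all: by end_near. Qed.

Lemma vanishingN H : vanishing H -> vanishing (fun n => - H n).
Proof.
move=> V d d0; near=> n => x x1; rewrite hornerN normcN.
by move: x x1; near: n; exact: V.
Unshelve. all: by end_near. Qed.

Lemma vanishing_shift H : vanishing H -> vanishing (fun n => H n.+1).
Proof.
move=> V d d0; have [N _ NH] := V d d0.
by exists N => // n /= Nn; apply: NH; rewrite /= (leq_trans Nn).
Qed.

Lemma invertible_mod D p : coprimep p D -> exists q, D %| p * q - 1.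
Proof.
move=> /Bezout_eq1_coprimepP[[u v] /= E]; exists u; apply/dvdpP; exists (- v).
by rewrite -E; ring.
Qed.

(** The Chinese remainder theorem keeps the remainders small, since the Bezout
    coefficients do not depend on the index of the sequence. *)
Lemma vanishing_mod_mul D1 D2 W : coprimep D1 D2 ->
  vanishing_mod D1 W -> vanishing_mod D2 W -> vanishing_mod (D1 * D2) W.
Proof.
move=> co [H1 V1 W1] [H2 V2 W2]; have [u /dvdpP[v uE]] := invertible_mod co.
exists (fun n => H1 n + (H2 n + - H1 n) * (D1 * u)).
  apply: vanishingD => //; apply: vanishingM; last exact: bounded_poly.
  by apply: vanishingD => //; exact: vanishingN.
move=> n; rewrite Gauss_dvdp//; apply/andP; split.
  have /dvdpP[q qE] := W1 n; apply/dvdpP; exists (q - (H2 n - H1 n) * u).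
  by rewrite [RHS]mulrBl -qE; ring.
have /dvdpP[q qE] := W2 n; apply/dvdpP; exists (q - (H2 n - H1 n) * v).
by rewrite [RHS]mulrBl -qE -[in RHS]mulrA -uE; ring.
Qed.

(** A factor that is invertible modulo [D] can be cancelled. *)
Lemma vanishing_mod_mull D H W (l p : {poly R[i]}) :
  D %| p * l - 1 -> vanishing H -> (forall n, D %| p * W n - H n) -> vanishing_mod D W.
Proof.
move=> /dvdpP[v vE] V WH; exists (fun n => H n * l).
  by apply: vanishingM => //; exact: bounded_poly.
move=> n; have /dvdpP[q qE] := WH n; apply/dvdpP; exists (q * l - v * W n).
by rewrite [RHS]mulrBl mulrAC -qE [v * _ * _]mulrAC -vE; ring.
Qed.

Lemma vanishing_mod_points (mz : seq (nat * R[i])) W :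
  uniq [seq e.2 | e <- mz] ->
  (forall e, e \in mz -> vanishing_mod (('X - e.2%:P) ^+ e.1) W) ->
  vanishing_mod (\prod_(e <- mz) ('X - e.2%:P) ^+ e.1) W.
Proof.
elim: mz => [_ _|e mz IHmz /= /andP[emz umz] V].
  exists (fun=> 0) => [d d0|n]; last by rewrite big_nil dvd1p.
  by near=> n => x x1; rewrite horner0 normc0 ltW.
rewrite big_cons; apply: vanishing_mod_mul; last first.
- by apply: IHmz => // e' e'mz; apply: V; rewrite inE e'mz orbT.
- exact/V/mem_head.
elim: mz emz {IHmz umz V} => [|e' mz IHmz]; first by rewrite big_nil coprimep1.
rewrite big_cons inE negb_or => /andP[ee' emz].
rewrite coprimepMr IHmz// andbT coprimep_expl// coprimep_expr//.
by rewrite coprimep_XsubC root_XsubC eq_sym.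
Unshelve. all: by end_near. Qed.

(** * Powers of the variable modulo a power of [X - z] *)

(** The Taylor polynomial of [X ^ n] at [z], of degree less than [m]. *)
Definition trunc_Xn (z : R[i]) m n : {poly R[i]} :=
  \sum_(j < m) ('C(n, j)%:R * z ^+ (n - j))%:P * ('X - z%:P) ^+ j.

Lemma dvdp_trunc_Xn z m n : ('X - z%:P) ^+ m %| 'X ^+ n - trunc_Xn z m n.
Proof.
have XE : 'X ^+ n = \sum_(0 <= j < n.+1) ('C(n, j)%:R * z ^+ (n - j))%:P * ('X - z%:P) ^+ j.
  rewrite -[in LHS](subrK z%:P 'X) addrC exprDn big_mkord; apply: eq_bigr => j _.
  by rewrite polyCM polyC_exp polyC_natr -mulrA mulr_natl.
rewrite /trunc_Xn -(big_mkord xpredT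
   (fun j => ('C(n, j)%:R * z ^+ (n - j))%:P * ('X - z%:P) ^+ j)) XE.
have [nm|mn] := leqP n.+1 m.
  rewrite (big_cat_nat (leq0n _) nm)//= opprD addNKr.
  rewrite big1_seq ?oppr0 ?dvdp0// => j /andP[_].
  by rewrite mem_index_iota => /andP[nj _]; rewrite bin_small// mul0r polyC0 mul0r.
rewrite (big_cat_nat (leq0n _) (ltnW mn))//= addrAC subrr add0r big_seq.
apply: (big_ind (fun p => ('X - z%:P) ^+ m %| p)) => [|p q|j]; [exact: dvdp0|exact: dvdp_add|].
by rewrite mem_index_iota => /andP[mj _]; apply: dvdp_mull; exact: dvdp_exp2l.
Qed.

(** Every term of the binomial expansion of [(normc z + k) ^+ n] is bounded by
    the sum. *)
Lemma trunc_Xn_le z m (k : R) n x : 0 < k <= 1 -> normc z <= 1 -> normc x <= 1 ->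
  normc (trunc_Xn z m n).[x] <= (normc z + k) ^+ n * \sum_(j < m) (2 / k) ^+ j.
Proof.
move=> /andP[k0 k1] z1 x1; rewrite /trunc_Xn horner_sum.
apply: le_trans (normc_sum _ _) _; rewrite big_distrr; apply: ler_sum => j _ /=.
rewrite hornerM hornerC horner_exp hornerXsubC normcM [normc ((x - z) ^+ j)]normcX.
have -> : (normc z + k) ^+ n * (2 / k) ^+ j = 2 ^+ j * ((normc z + k) ^+ n / k ^+ j).
  by rewrite exprMn exprVn; ring.
apply: (@le_trans _ _ (2 ^+ j * normc ('C(n, j)%:R * z ^+ (n - j)))).
  rewrite mulrC ler_wpM2r ?normc_ge0// lerXn2r ?nnegrE ?normc_ge0//.
  by apply: le_trans (le_normcD _ _) _; rewrite normcN; lra.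
rewrite ler_wpM2l ?exprn_ge0// ler_pdivlMr ?exprn_gt0//.
rewrite normcM [normc (z ^+ _)]normcX.
have -> : normc 'C(n, j)%:R = 'C(n, j)%:R :> R.
  by rewrite -(rmorph_nat (real_complex R)) normc_real ger0_norm.
have [nj|jn] := ltnP n j.
  by rewrite bin_small// !mul0r exprn_ge0// addr_ge0 ?normc_ge0// ltW.
rewrite exprDn (bigD1 (Ordinal (jn : (j < n.+1)%N)))//= -[leLHS]mulrA mulr_natl lerDl.
apply: sumr_ge0 => i _; rewrite mulrn_wge0// mulr_ge0 ?exprn_ge0 ?normc_ge0//.
by rewrite ltW.
Qed.

End VanishingModulo.

(** * Entries of square summable sequences *)

Section SquareSummableEntries.
Context {R : realType}.
Implicit Types (x : l2 R) (u : nat -> R[i]).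

Lemma ge0_fin_sqsum u : u \in square_summable -> sqsum u \is a fin_num.
Proof.
move=> /square_summableP ufin; rewrite ge0_fin_numE//.
by apply: nneseries_ge0 => n _ _; rewrite lee_fin sqr_ge0.
Qed.

Lemma normc_entry_le_l2norm x n : normc (x n) <= l2norm x.
Proof.
rewrite /l2norm -(@ler_pXn2r _ 2) ?nnegrE ?normc_ge0 ?sqrtr_ge0//.
have x0 k : (0 <= (normc (x k) ^+ 2)%:E)%E by rewrite lee_fin sqr_ge0.
rewrite sqr_sqrtr; last by apply/fine_ge0/nneseries_ge0.
rewrite -lee_fin fineK ?ge0_fin_sqsum ?l2valP//.
apply: le_trans (nneseries_lim_ge n.+1 _) => //.
rewrite big_nat_recr//= leeDr//; apply: sume_ge0 => k _; exact: x0.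
Qed.

End SquareSummableEntries.

(** * Root vectors force the Jost polynomials to vanish *)

Section RootVectors.
Context {R : realType}.
Implicit Types (z x : R[i]) (c : nat -> R[i]) (J : jacobi R).

Lemma normc_prod_growth c (eta : R) : 0 < eta ->
  (\forall n \near \oo, normc (c n) <= 1 + eta) ->
  exists2 G, 0 <= G &
    \forall n \near \oo, normc (\prod_(0 <= k < n) c k) <= G * (1 + eta) ^+ n.
Proof.
move=> eta0 [N _ Nc]; exists (normc (\prod_(0 <= k < N) c k)); first exact: normc_ge0.
exists N => // n /= Nn; rewrite -(subnK Nn).
elim: (n - N)%N => [|k IHk].
  by rewrite add0n ler_peMr ?normc_ge0// exprn_ege1// lerDl ltW.
rewrite addSn big_nat_recr//= normcM exprSr mulrA ler_pM ?normc_ge0//.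
by apply: Nc; rewrite /= leq_addl.
Qed.

Lemma near_geom_le (q C d : R) : 0 <= q < 1 -> 0 < d ->
  \forall n \near \oo, C * q ^+ n <= d.
Proof.
move=> /andP[q0 q1] d0.
have /cvgr0_norm_le : (fun n => C * q ^+ n) @ \oo --> (0 : R).
  rewrite -(mulr0 C); apply: cvgM; first exact: cvg_cst.
  by apply: cvg_expr; rewrite ger0_norm.
move=> /(_ _ d0); apply: filterS => n; apply: le_trans; exact: ler_norm.
Qed.

Lemma vanishing_prod_trunc_Xn c z m : normc z < 1 ->
  (forall eta : R, 0 < eta -> \forall n \near \oo, normc (c n) <= 1 + eta) ->
  vanishing (fun n => (\prod_(0 <= k < n) c k)%:P * trunc_Xn z m n).
Proof.
move=> z1 cn d d0.
(* [k] is such that [r < 1], and then also [(1 + (1 - r)) * r < 1]. *)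
pose k := (1 - normc z) / 2; pose r := normc z + k.
have z0 := normc_ge0 z.
have k0 : 0 < k by rewrite divr_gt0// subr_gt0.
have k1 : k <= 1 by rewrite /k; lra.
have r0 : 0 <= r by rewrite addr_ge0// ltW.
have r1 : r < 1 by rewrite /r /k; lra.
have eta0 : 0 < 1 - r by rewrite subr_gt0.
have [G G0 cG] := normc_prod_growth eta0 (cn _ eta0).
pose S := \sum_(j < m) (2 / k) ^+ j.
have S0 : 0 <= S by apply: sumr_ge0 => j _; rewrite exprn_ge0// divr_ge0// ltW.
pose q := (1 + (1 - r)) * r.
have q01 : 0 <= q < 1.
  by rewrite /q mulr_ge0//=; [nra|lra].
near=> n => x x1.
rewrite hornerM hornerC normcM.
have h1 : G * S * q ^+ n <= d by near: n; exact: near_geom_le.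
apply: le_trans h1; rewrite exprMn.
have -> : G * S * ((1 + (1 - r)) ^+ n * r ^+ n) =
  (G * (1 + (1 - r)) ^+ n) * (r ^+ n * S) by ring.
rewrite ler_pM ?normc_ge0//; first by near: n.
by rewrite trunc_Xn_le ?k0 ?(ltW z1).
Unshelve. all: by end_near. Qed.

Variables (J : jacobi R) (z : R[i]) (m : nat) (y : l2 R).
Hypothesis z0 : z != 0.
Let lam := z + z^-1.
Let N := shifted (jacobi_op J) lam.
Let D : {poly R[i]} := ('X - z%:P) ^+ m.+1.
Let wJ n := subdiag J n * superdiag J n.
Hypothesis yN : iter m.+1 N y = 0.

(** A Jordan chain of length [m.+1] as one formal eigenvector
    [\sum_(i <= m) y_i t ^ i] for the eigenvalue [lam + t], modulo [t ^ m.+1]. *)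
Let formal_vector (t : {poly R[i]}) n : {poly R[i]} :=
  \sum_(i < m.+1) (iter (m - i) N y n)%:P * t ^+ i.

Lemma formal_vector_rec t n : formal_vector t n * (lam%:P + t) =
  (if n is k.+1 then (subdiag J k)%:P * formal_vector t k else 0)
  + (diag J n)%:P * formal_vector t n + (superdiag J n)%:P * formal_vector t n.+1
  + (y n)%:P * t ^+ m.+1.
Proof.
pose U i := (iter (m.+1 - i) N y n)%:P * t ^+ i.
have NE (u : l2 R) : N u n + lam * u n = jacobi_seq J u n.
  by rewrite /N /shifted /=; exact: subrK.
have tY : formal_vector t n * t = \sum_(i < m.+1) U i + (y n)%:P * t ^+ m.+1.
  have : \sum_(i < m.+1) U i + U m.+1 = U 0%N + \sum_(i < m.+1) U i.+1.
    transitivity (\sum_(i < m.+2) U i); first by rewrite [RHS]big_ord_recr.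
    by rewrite big_ord_recl.
  rewrite {2}/U subnn /= => ->.
  have -> : U 0%N = 0 by rewrite /U subn0 yN /= mul0r.
  rewrite add0r mulr_suml; apply: eq_bigr => i _.
  by rewrite /U subSS exprSr mulrA.
rewrite mulrDr tY addrA; congr (_ + _).
have -> : formal_vector t n * lam%:P + \sum_(i < m.+1) U i =
   \sum_(i < m.+1) (jacobi_seq J (iter (m - i) N y) n)%:P * t ^+ i.
  rewrite mulr_suml -big_split /=; apply: eq_bigr => i _.
  rewrite /U subSn -1?ltnS// iterS -NE [in RHS]polyCD [in RHS]polyCM; ring.
rewrite /jacobi_seq; case: n {NE tY U} => [|n].
  rewrite add0r !mulr_sumr -big_split /=; apply: eq_bigr => i _.
  by rewrite add0r polyCD !polyCM; ring.
rewrite !mulr_sumr -!big_split /=; apply: eq_bigr => i _.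
by rewrite !polyCD !polyCM; ring.
Qed.

(** The recurrence has a one-dimensional space of solutions, so the formal
    eigenvector is its first entry times the solution given by the truncations. *)
Lemma formal_vector_truncations t i n : D %| 'X * i - 1 -> D %| t ^+ m.+1 ->
  lam%:P + t = 'X + i ->
  D %| 'X ^+ n * (\prod_(0 <= k < n) superdiag J k)%:P * formal_vector t n
       - formal_vector t 0 * (truncations (diag J) wJ n).1.
Proof.
move=> /dvdpP[e1 E1] /dvdpP[e2 E2] lt.
pose g n := (\prod_(0 <= k < n) superdiag J k)%:P.
pose Z n := 'X ^+ n * g n * formal_vector t n.
pose Q n := if n is k.+1 then Z k else 0.
pose P n := truncations (diag J) wJ n.
suff [] : D %| Z n - formal_vector t 0 * (P n).1 /\
  D %| Q n - formal_vector t 0 * (P n).2 by [].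
elim: n => [|n [/dvdpP[z1 Z1] /dvdpP[z2 Z2]]].
  split; last by rewrite /= mulr0 subrr dvdp0.
  by rewrite /Z /g big_geq// polyC1 expr0 !mul1r mulr1 subrr dvdp0.
split; last by apply/dvdpP; exists z1.
pose A : {poly R[i]} := if n is k.+1 then (subdiag J k)%:P * formal_vector t k else 0.
have rec := formal_vector_rec t n; rewrite -/A in rec.
have gS : g n.+1 = g n * (superdiag J n)%:P by rewrite /g big_nat_recr//= polyCM.
have QE : 'X ^+ n.+1 * g n * A = (wJ n.-1)%:P * 'X ^+ 2 * Q n.
  case: n @A {rec gS Z1 Z2} => [|n] A; first by rewrite /Q !mulr0.
  rewrite /Q /Z /g /A big_nat_recr//= /wJ !polyCM !exprS; ring.
apply/dvdpP.
exists (((1 + 'X ^+ 2 - (diag J n)%:P * 'X) * z1 + e1 * Z n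
   - (wJ n.-1)%:P * 'X ^+ 2 * z2) - 'X ^+ n.+1 * g n * (y n)%:P * e2).
have ZS : Z n.+1 = ('X * ('X + i) - (diag J n)%:P * 'X) * Z n
    - (wJ n.-1)%:P * 'X ^+ 2 * Q n - 'X ^+ n.+1 * g n * (y n)%:P * t ^+ m.+1.
  rewrite -QE -lt.
  transitivity ('X ^+ n.+1 * g n * ((superdiag J n)%:P * formal_vector t n.+1)).
    by rewrite /Z gS; ring.
  have -> : (superdiag J n)%:P * formal_vector t n.+1 =
     formal_vector t n * (lam%:P + t) - A - (diag J n)%:P * formal_vector t n - (y n)%:P * t ^+ m.+1 by rewrite rec; ring.
  by rewrite /Z ['X ^+ n.+1]exprS; ring.
rewrite ZS E2 /P /= -/(P n).
have -> : 'X * ('X + i) = 'X ^+ 2 + 1 + e1 * D by rewrite -E1; ring.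
have ZE : Z n = formal_vector t 0 * (P n).1 + z1 * D by rewrite -Z1; ring.
have -> : Q n = formal_vector t 0 * (P n).2 + z2 * D by rewrite -Z2; ring.
by rewrite ZE; ring.
Qed.

(** The deviation [t] of the formal eigenvalue [X + X^-1] from [lam] vanishes at
    [z], hence is nilpotent modulo [D]. *)
Lemma formal_eigenvalue : exists i t, [/\ D %| 'X * i - 1, D %| t ^+ m.+1,
  lam%:P + t = 'X + i & root t z].
Proof.
have [|i iE] := @invertible_mod R D 'X.
  by rewrite coprimep_expr// coprimep_XsubC rootX.
have zi : z * i.[z] = 1.
  have : root ('X * i - 1) z.
    rewrite -dvdp_XsubCl; apply: dvdp_trans iE.
    by rewrite /D exprS dvdp_mulr.
  by rewrite rootE !hornerE subr_eq0 => /eqP.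
exists i, ('X + i - lam%:P).
have tz : root ('X + i - lam%:P) z.
  rewrite rootE !hornerE /lam; have -> : i.[z] = z^-1.
    by rewrite -[LHS](mulKf z0) zi mulr1.
  by rewrite subrr.
split => //; last by rewrite addrC subrK.
by apply: dvdp_exp2r; rewrite dvdp_XsubCl.
Qed.

Hypothesis z1 : normc z < 1.
Hypothesis superdiag_lim : forall eta : R, 0 < eta ->
  \forall n \near \oo, normc (superdiag J n) <= 1 + eta.
Hypothesis y0 : iter m N y 0%N != 0.

(** Modulo [D] the truncations are the formal eigenvector, whose coefficients are
    bounded because the chain lies in [l2], times [X ^ n] and a product of
    superdiagonal entries, which together decay since [normc z < 1]. *)
Lemma jost_vanishing : vanishing_mod D (fun n => jost (diag J) wJ n.+1).
Proof.
have [i [t [iE tE lt tz]]] := formal_eigenvalue.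
have [|l lE] := @invertible_mod R D (formal_vector t 0).
  rewrite coprimep_expr// coprimep_XsubC.
  rewrite rootE /formal_vector big_ord_recl subn0 expr0 mulr1 hornerD hornerC.
  rewrite horner_sum big1 ?addr0// => k _.
  by rewrite hornerM horner_exp (rootP tz) expr0n mulr0.
have VP : vanishing_mod D (fun n => (truncations (diag J) wJ n).1).
  apply: (vanishing_mod_mull lE (H := fun n =>
    (\prod_(0 <= k < n) superdiag J k)%:P * trunc_Xn z m.+1 n * formal_vector t n)).
    apply: vanishingM; first exact: vanishing_prod_trunc_Xn.
    apply: bounded_on_disc_sum => k; apply: bounded_on_discM; last exact: bounded_poly.
    by exists (l2norm (iter (m - k) N y)) => n x _; rewrite hornerC normc_entry_le_l2norm.
  move=> n; have /dvdpP[q qE] := formal_vector_truncations n iE tE lt.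
  have /dvdpP[q' qE'] := dvdp_trunc_Xn z m.+1 n.
  apply/dvdpP; exists (- q + (\prod_(0 <= k < n) superdiag J k)%:P * formal_vector t n * q').
  by rewrite mulrDl mulNr -qE -[_ * q' * D]mulrA -qE'; ring.
have [H V HW] := VP.
exists (fun n => H n.+1 + (- H n) * 'X ^+ 2).
  apply: vanishingD; first exact: vanishing_shift.
  by apply: vanishingM; [exact: vanishingN|exact: bounded_poly].
move=> n; have := dvdp_sub (HW n.+1) (dvdp_mull ('X ^+ 2) (HW n)).
by congr (_ %| _); rewrite /jost /=; ring.
Qed.

End RootVectors.

(** * Jordan chains from the algebraic multiplicity *)

Section JordanChain.
Context {R : realType}.
Variables (J : jacobi R) (lam : R[i]).
Let N := shifted (jacobi_op J) lam.

Lemma shifted_is_linear (k : R[i]) (x y : l2 R) : N (k *: x + y) = k *: N x + N y.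
Proof.
rewrite /N /shifted linearP scalerDr scalerBr !scalerA (mulrC lam k).
by rewrite opprD addrACA.
Qed.

Lemma shifted0 : N 0 = 0.
Proof. by rewrite /N /shifted linear0 scaler0 subrr. Qed.

Lemma iter_shifted_sum k n (u : 'I_n -> R[i]) (e : 'I_n -> l2 R) :
  iter k N (\sum_i u i *: e i) = \sum_i u i *: iter k N (e i).
Proof.
elim: k => [//|k IHk]; rewrite iterS IHk.
elim/big_rec2: _ => [|i x y _ <-]; first exact: shifted0.
by rewrite shifted_is_linear iterS.
Qed.

Lemma l2_sumE n (u : 'I_n -> R[i]) (e : 'I_n -> l2 R) k :
  (\sum_i u i *: e i) k = \sum_i u i * e i k.
Proof. by elim/big_rec2: _ => [//|i x y _ <-]. Qed.

(** The superdiagonal entries are nonzero, so a formal solution is determined by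
    its first entry. *)
Lemma kernel_at0 (x : l2 R) : N x = 0 -> x 0%N = 0 -> x = 0.
Proof.
move=> Nx x0; apply/val_inj/funext => n.
suff [] : x n = 0 /\ x n.+1 = 0 by [].
have step k : (if k is j.+1 then x j else 0) = 0 -> x k = 0 -> x k.+1 = 0.
  move=> xj xk; have : jacobi_seq J x k - lam * x k = 0.
    exact: (congr1 (fun v : l2 R => v k) Nx).
  rewrite /jacobi_seq xk !mulr0 subr0 addr0.
  have -> : (if k is j.+1 then subdiag J j * x j else 0) = 0.
    by case: k xj {xk} => [//|j] ->; rewrite mulr0.
  rewrite add0r => /eqP; rewrite mulf_eq0 => /orP[|/eqP//].
  by have := jacobi_neq0 J k; rewrite mulf_eq0 negb_or => /andP[_ /negPf ->].
elim: n => [|n [xn xn1]]; first by split => //; exact: step.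
by split => //; apply: step.
Qed.

Lemma iter_kernel_at0 m (x : l2 R) : iter m N x = 0 ->
  (forall k, (k < m)%N -> iter k N x 0%N = 0) -> x = 0.
Proof.
elim: m => [//|m IHm] /= Nx x0; apply: IHm => [|k km]; last exact/x0/ltnW.
by apply: kernel_at0 => //; exact: x0.
Qed.

(** The kernel of the [m]-th power has dimension at most [m], so a root space of
    dimension [m.+1] contains a vector of height greater than [m]. *)
Lemma root_space_chain m : has_dim (root_space (jacobi_op J) lam) m.+1 ->
  exists2 y : l2 R, iter m.+1 N y = 0 & iter m N y 0%N != 0.
Proof.
move=> [e [espan eunique]].
have [x [k xk] xm] : exists2 x : l2 R, (exists k, iter k N x = 0) & iter m N x != 0.
  apply: contrapT => H.
  have Em x : root_space (jacobi_op J) lam x -> iter m N x = 0.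
    by move=> Ex; apply/eqP; apply: contrapT => /negP xm; apply: H; exists x.
  (* A vector of the kernel of the [m]-th power is determined by [m] numbers. *)
  pose A : 'M[R[i]]_(m.+1, m) := \matrix_(i, k) (iter k N (e i) 0%N).
  have : kermx A != 0.
    rewrite kermx_eq0 /row_free; apply/negP => /eqP rA.
    by have := rank_leq_col A; rewrite rA ltnn.
  move=> /rowV0Pn[v /sub_kermxP vA v0].
  pose x := \sum_i v 0 i *: e i.
  have Ex : root_space (jacobi_op J) lam x by exact: espan.
  have x0 : x = 0.
    apply: (iter_kernel_at0 (Em x Ex)) => k km.
    rewrite iter_shifted_sum l2_sumE.
    have := congr1 (fun B : 'rV__ => B 0 (Ordinal km)) vA.
    rewrite !mxE => vA0; rewrite -[RHS]vA0.
    by apply: eq_bigr => i _; rewrite mxE.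
  have E0 : root_space (jacobi_op J) lam 0 by exists 0%N.
  have [u [_ uu]] := eunique 0 E0.
  have uv : u = (fun i => v 0 i) by apply: uu; rewrite -[LHS]x0.
  have u0 : u = (fun=> 0) by apply: uu; rewrite big1// => i _; rewrite scale0r.
  move/eqP: v0; apply; apply/rowP => i; rewrite mxE.
  by rewrite -[RHS]/((fun=> 0) i) -u0 uv.
have iter0 j : iter j N 0 = 0 by elim: j => //= j ->; exact: shifted0.
have ex : exists k, iter k N x == 0 by exists k; apply/eqP.
case: (ex_minnP ex) => j /eqP xj jmin {ex k xk}.
have mj : (m < j)%N.
  rewrite ltnNge; apply/negP => jm; move/eqP: xm; apply.
  by rewrite -(subnK jm) iterD xj iter0.
have [d jE] : exists d, j = (m.+1 + d)%N by exists (j - m.+1)%N; rewrite subnKC.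
exists (iter d N x); first by rewrite -iterD -jE.
apply/negP => /eqP y0; have : iter (m + d) N x == 0.
  rewrite iterD; apply/eqP; apply: kernel_at0 => //.
  by rewrite -iterS -iterD -jE.
by move/jmin; rewrite jE addSn ltnn.
Qed.

End JordanChain.

(** * Off-diagonal entries of a trace class operator *)

Section TraceClassEntries.
Context {R : realType}.
Implicit Types (x y : l2 R) (u : nat -> R[i]).

Lemma l2inner_finite x y L : (forall k, (L <= k)%N -> x k * conjc (y k) = 0) ->
  l2inner x y = \sum_(0 <= k < L) x k * conjc (y k).
Proof.
move=> xy0; apply: (@norm_lim_near_cst _ R[i]^o); near=> n.
have Ln : (L <= n)%N by near: n; exact: nbhs_infty_ge.
rewrite (big_cat_nat (leq0n _) Ln) /= [X in _ + X]big1_seq ?addr0// => k /andP[_].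
by rewrite mem_index_iota => /andP[/xy0].
Unshelve. all: by end_near. Qed.

Lemma sum_delta u k L : (k < L)%N ->
  \sum_(0 <= j < L) u j * conjc ((j == k)%:R : R[i]) = u k.
Proof.
move=> kL; rewrite (bigD1_seq k) ?mem_index_iota ?iota_uniq//= eqxx conjc1 mulr1.
by rewrite big1 ?addr0// => j /negPf ->; rewrite conjc0 mulr0.
Qed.

Lemma l2inner_basis2 y (a b : R[i]) k n :
  l2inner y (a *: l2basis k + b *: l2basis n) = conjc a * y k + conjc b * y n.
Proof.
have E j : y j * conjc ((a *: l2basis k + b *: l2basis n) j) =
   conjc a * (y j * conjc ((j == k)%:R : R[i])) + conjc b * (y j * conjc ((j == n)%:R : R[i])).
  have -> : (a *: l2basis k + b *: l2basis n) j = a * (j == k)%:R + b * (j == n)%:R.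
    by [].
  by rewrite rmorphD !rmorphM /=; ring.
rewrite (l2inner_finite (L := maxn k.+1 n.+1)) => [|j].
  under eq_bigr do rewrite E.
  by rewrite big_split /= -!mulr_sumr !sum_delta// leq_max ltnSn ?orbT.
rewrite geq_max E => /andP[kj nj].
by rewrite !gtn_eqF// conjc0 !mulr0 addr0.
Qed.

(** The determinant inequality for a positive matrix; its Hermitian symmetry,
    [c = conjc b], also comes from positivity. *)
Lemma positive_2x2 (a b c d : R[i]) :
  (forall s t : R[i], 0 <= conjc s * (s * a + t * b) + conjc t * (s * c + t * d)) ->
  normc b * normc c <= complex.Re a * complex.Re d.
Proof.
case: a => a a'; case: b => b b'; case: c => c c'; case: d => d d' pos.
have := pos 1 0; have := pos 0 1; have := pos 1 1; have := pos 1 'i.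
(* The minimum of the quadratic form is on this line. *)
have posR t := pos 1 (t * b -i* (t * b')).
simpc => /andP[/eqP h1 h1'] /andP[/eqP h2 h2'] /andP[/eqP h3 h3'] /andP[/eqP h4 h4'].
have ec : c = b by lra.
have ec' : c' = - b' by lra.
have ea : a' = 0 by lra.
have ed : d' = 0 by lra.
rewrite ec ec' /= sqrrN -expr2 sqr_sqrtr ?addr_ge0 ?sqr_ge0//.
set p := b ^+ 2 + b' ^+ 2.
have p0 : 0 <= p by rewrite addr_ge0 ?sqr_ge0.
have quad t : 0 <= a + 2 * t * p + t ^+ 2 * p * d.
  have := posR t; simpc => /andP[_].
  by rewrite ec ec' ?ea ?ed => h; apply: le_trans h _; rewrite le_eqVlt; apply/orP; left; apply/eqP; rewrite /p; ring.
have a0 : 0 <= a by lra.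
have d0 : 0 <= d by lra.
have [->|pn0] := eqVneq p 0; first by rewrite mulr_ge0.
have {p0 pn0} p0 : 0 < p by rewrite lt_neqAle eq_sym pn0.
have [dE|dn0] := eqVneq d 0.
  have := quad (- (a + 1) / (2 * p)); rewrite dE mulr0 addr0.
  have -> : a + 2 * (- (a + 1) / (2 * p)) * p = -1 by field; rewrite gt_eqF.
  lra.
have {d0 dn0} d0 : 0 < d by rewrite lt_neqAle eq_sym dn0.
have := quad (- d^-1).
have -> : a + 2 * - d^-1 * p + (- d^-1) ^+ 2 * p * d = (a * d - p) / d.
  by field; rewrite gt_eqF.
by rewrite pmulr_lge0 ?invr_gt0// subr_ge0.
Qed.

Section PositiveOperator.
Variables (A : {linear l2 R -> l2 R}) (M : R).
Hypothesis A_bounded : forall x, l2norm (A x) <= M * l2norm x.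
Hypothesis A_pos : forall x, 0 <= l2inner (A x) x.

Let a k n : R[i] := A (l2basis n) k.

Lemma basis_inner n : l2inner (A (l2basis n)) (l2basis n) = a n n.
Proof.
rewrite (l2inner_finite (L := n.+1)) => [|j nj]; last first.
  by rewrite /= gtn_eqF// conjc0 mulr0.
exact: (sum_delta (A (l2basis n))).
Qed.

Lemma entries_le k n : normc (a k n) * normc (a n k) <= complex.Re (a k k) * complex.Re (a n n).
Proof.
apply: positive_2x2 => s t; have := A_pos (s *: l2basis k + t *: l2basis n).
by rewrite l2inner_basis2 linearD !linearZ.
Qed.

Lemma Re_diag_ge0 n : 0 <= complex.Re (a n n).
Proof.
have := A_pos (l2basis n); rewrite basis_inner.
by case: (a n n) => r s; rewrite lecE => /andP[].
Qed.

Definition l2head x L : l2 R := \sum_(k < L) x k *: l2basis k.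

Lemma l2headE x L j : l2head x L j = if (j < L)%N then x j else 0.
Proof.
have -> : l2head x L j = \sum_(0 <= k < L) x k * conjc ((k == j)%:R : R[i]).
  rewrite big_mkord /l2head; elim/big_rec2: _ => [//|k u v _ <-].
  rewrite eq_sym; have -> : conjc ((j == k)%:R : R[i]) = (j == k)%:R.
    by case: (j == k :> nat); rewrite ?conjc1 ?conjc0.
  by [].
case: ltnP => jL; first exact: (sum_delta x).
rewrite big1_seq// => k /andP[_]; rewrite mem_index_iota => /andP[_ kL].
by rewrite ltn_eqF ?conjc0 ?mulr0// (leq_trans kL).
Qed.

Lemma l2norm_tail x (d : R) : 0 < d -> \forall L \near \oo, l2norm (x - l2head x L) <= d.
Proof.
move=> d0; have xfin : (sqsum x < +oo)%E by have /square_summableP := l2valP x.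
have x0 k : (0 <= (normc (x k) ^+ 2)%:E)%E by rewrite lee_fin sqr_ge0.
have tailE L : sqsum (x - l2head x L) = (\sum_(L <= k <oo) (normc (x k) ^+ 2)%:E)%E.
  rewrite [RHS]eseries_cond [RHS]eseries_mkcond /sqsum.
  apply: eq_eseriesr => k _.
  have -> : (x - l2head x L : l2 R) k = x k - l2head x L k by [].
  rewrite l2headE; case: ltnP => Lk; first by rewrite subrr normc0 expr0n.
  by rewrite subr0.
have /fine_cvgP[_] := nneseries_tail_cvg (P := xpredT) xfin (fun k _ => x0 k).
have d2 : 0 < d ^+ 2 by rewrite exprn_gt0.
move=> /cvgr0_norm_le /(_ _ d2); apply: filterS => L tL.
rewrite /l2norm -(@ler_pXn2r _ 2) ?nnegrE ?sqrtr_ge0 ?(ltW d0)//.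
rewrite tailE sqr_sqrtr; last by apply/fine_ge0/nneseries_ge0.
by apply: le_trans tL; exact: ler_norm.
Qed.

(** Formally, the [n]-th diagonal entry of [A ^ 2] is the sum over [k] of
    [a n k * a k n], and [entries_le] bounds the terms.  Boundedness of [A] allows
    to replace the column of index [n] by its finite heads. *)
Lemma diag_sqr_le (tau : R) n : (forall L, \sum_(k < L) complex.Re (a k k) <= tau) ->
  normc (A (A (l2basis n)) n) <= tau * complex.Re (a n n).
Proof.
move=> trA; apply/ler_addgt0Pr => d d0.
have d0' : 0 < d / (`|M| + 1) by rewrite divr_gt0// ltr_wpDl.
have [L uL] := filter_ex (l2norm_tail (A (l2basis n)) d0').
set u := A (l2basis n) in uL *.
have -> : A u = A (l2head u L) + A (u - l2head u L) by rewrite -linearD addrC subrK.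
have -> : (A (l2head u L) + A (u - l2head u L)) n =
   A (l2head u L) n + A (u - l2head u L) n by [].
apply: le_trans (le_normcD _ _) _; apply: lerD.
  have -> : A (l2head u L) n = \sum_(k < L) u k * a n k.
    rewrite /l2head linear_sum; elim/big_rec2: _ => [//|k v w _ <-].
    by rewrite linearZ.
  apply: le_trans (normc_sum _ _) _.
  apply: (@le_trans _ _ (\sum_(k < L) complex.Re (a k k) * complex.Re (a n n))).
    by apply: ler_sum => k _; rewrite normcM; exact: entries_le.
  by rewrite -mulr_suml ler_wpM2r ?Re_diag_ge0.
apply: le_trans (normc_entry_le_l2norm _ _) _; apply: le_trans (A_bounded _) _.
have MM : M <= `|M| + 1 by apply: le_trans (ler_norm _) _; rewrite lerDl.
apply: (@le_trans _ _ ((`|M| + 1) * l2norm (u - l2head u L))).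
  by rewrite ler_wpM2r ?sqrtr_ge0.
rewrite mulrC -ler_pdivlMr//; exact: ltr_wpDl.
Qed.

End PositiveOperator.

Lemma jacobi_op_basis (J : jacobi R) n k :
  jacobi_op J (l2basis n.+1) k =
  (if k is m.+1 then subdiag J m * (m == n.+1)%:R else 0)
  + diag J k * (k == n.+1)%:R + superdiag J k * (k.+1 == n.+1)%:R.
Proof. by []. Qed.

(** With [T] the perturbation and [A] its absolute value, the norm of [T] on a
    basis vector bounds the superdiagonal entry minus one, and its square is a
    diagonal entry of [A ^ 2], hence at most the trace of [A] times a term of the
    convergent series that defines the trace. *)
Lemma trace_class_superdiag (J : jacobi R) :
  trace_class (jacobi_op J \- jacobi_op laplacian) ->
  forall eta : R, 0 < eta -> \forall n \near \oo, normc (superdiag J n) <= 1 + eta.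
Proof.
move=> [_ [A [[M AM] Apos [S TS AS]] trA]] eta eta0.
pose e n : l2 R := l2basis n.
pose r n := complex.Re (A (e n) n).
have r0 n : (0 <= (r n)%:E)%E by rewrite lee_fin; exact: Re_diag_ge0.
have {}trA : (\sum_(0 <= n <oo) (r n)%:E < +oo)%E.
  by under eq_eseriesr do rewrite /r -(basis_inner A).
pose tau := fine (\sum_(0 <= n <oo) (r n)%:E)%E.
have tr_le L : \sum_(k < L) r k <= tau.
  rewrite -lee_fin fineK; last by rewrite ge0_fin_numE// nneseries_ge0.
  rewrite -(big_mkord xpredT r) -sumEFin.
  by apply: nneseries_lim_ge.
have tau0 : 0 <= tau by have := tr_le 0%N; rewrite big_ord0.
have entry n : normc (superdiag J n - 1) ^+ 2 <= tau * r n.+1.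
  apply: le_trans (diag_sqr_le AM Apos n.+1 tr_le).
  pose te : l2 R := (jacobi_op J \- jacobi_op laplacian) (e n.+1).
  have teE k : te k = jacobi_op J (e n.+1) k - jacobi_op laplacian (e n.+1) k by [].
  have ten : te n = superdiag J n - 1.
    rewrite teE !jacobi_op_basis eqxx (ltn_eqF (ltnSn n)).
    case: (n) => [|m]; first by rewrite /=; ring.
    by rewrite (ltn_eqF (ltnW (ltnSn m.+1))) /=; ring.
  have te0 k : (n.+3 <= k)%N -> te k = 0.
    case: k => [//|k] nk; rewrite teE !jacobi_op_basis.
    have -> : (k == n.+1) = false by rewrite gtn_eqF.
    have -> : (k.+1 == n.+1) = false by rewrite gtn_eqF// ltnW.
    have -> : (k.+2 == n.+1) = false by rewrite gtn_eqF// ltnW// ltnW.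
    by rewrite /= !mulr0 !addr0 subrr.
  have inner_te : l2inner te te = (\sum_(0 <= k < n.+3) normc (te k) ^+ 2)%:C.
    rewrite (l2inner_finite (L := n.+3)) => [|k /te0 ->]; last by rewrite mul0r.
    rewrite rmorph_sum; apply: eq_bigr => k _ /=.
    exact: mulc_conj.
  have inner_AA : l2inner te te = conjc (A (A (e n.+1)) n.+1).
    rewrite TS /= -/te -[S _](AS (e n.+1)) (l2inner_finite (L := n.+2)).
      rewrite -[RHS](sum_delta (fun j => conjc (A (A (e n.+1)) j)) (ltnSn n.+1)).
      apply: eq_bigr => k _; rewrite mulrC; congr (_ * _).
      by rewrite /=; case: (k == n.+1); rewrite ?conjc1 ?conjc0.
    by move=> k nk; rewrite /= gtn_eqF// mul0r.
  rewrite -[leRHS]normc_conj -inner_AA inner_te normc_real ger0_norm; last first.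
    by apply: sumr_ge0 => k _; rewrite sqr_ge0.
  rewrite -ten (bigD1_seq n) ?mem_index_iota ?iota_uniq//=; last by rewrite ltnW// ltnW.
  by rewrite lerDl sumr_ge0// => k _; rewrite sqr_ge0.
have d0 : 0 < eta ^+ 2 / (tau + 1) by rewrite divr_gt0 ?exprn_gt0// ltr_wpDl.
have /fine_cvgP[tf /cvgr0_norm_le /(_ _ d0)] := nneseries_tail_cvg (P := xpredT) trA (fun k _ => r0 k).
move=> [N _ tN]; case: tf => N' _ tN'.
near=> n.
have rn : r n.+1 <= eta ^+ 2 / (tau + 1).
  have Nn : (N <= n.+1)%N by near: n; exists N => // n /= ; exact: leqW.
  have N'n : (N' <= n.+1)%N by near: n; exists N' => // n /= ; exact: leqW.
  apply: le_trans (le_trans (ler_norm _) (tN _ Nn)).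
  rewrite -lee_fin fineK; last exact: tN'.
  apply: le_trans (nneseries_lim_ge n.+2 _) => //.
  by rewrite big_nat1.
have : normc (superdiag J n - 1) <= eta.
  rewrite -(@ler_pXn2r _ 2) ?nnegrE ?normc_ge0 ?(ltW eta0)//.
  apply: le_trans (entry n) _.
  apply: (@le_trans _ _ (tau * (eta ^+ 2 / (tau + 1)))); first by rewrite ler_wpM2l.
  by rewrite mulrCA ger_pMr ?exprn_gt0// ler_pdivrMr ?ltr_wpDl// mul1r lerDl.
have := normc_subD (superdiag J n) (- 1); rewrite normcN normc1; lra.
Unshelve. all: by end_near. Qed.

End TraceClassEntries.

(** * The Joukowski parametrisation of the eigenvalues *)

Section Eigenvalues.
Context {R : realType}.
Implicit Types (z lam : R[i]).

Lemma joukowski_exists lam : exists z, [/\ z != 0, normc z <= 1 & lam = z + z^-1].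
Proof.
pose s := sqrtc (lam ^+ 2 - 4).
pose z1 := (lam + s) / 2; pose z2 := (lam - s) / 2.
have z12 : z1 * z2 = 1.
  have -> : z1 * z2 = (lam ^+ 2 - s ^+ 2) / 4 by rewrite /z1 /z2; field.
  by rewrite sqr_sqrtc; field.
have zlam : z1 + z2 = lam by rewrite /z1 /z2; field.
have main z w : z * w = 1 -> z + w = lam -> normc z <= 1 ->
    exists z, [/\ z != 0, normc z <= 1 & lam = z + z^-1].
  move=> zw zwl z_le1; have z0 : z != 0.
    by apply/eqP => z0; move: zw; rewrite z0 mul0r => /esym/eqP; rewrite oner_eq0.
  by exists z; split => //; rewrite -zwl -[w](mulKf z0) zw mulr1.
have [z_le1|z1_gt1] := leP (normc z1) 1; first exact: main z12 zlam z_le1.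
apply: (main z2 z1); rewrite 1?mulrC 1?addrC//.
have : normc z1 * normc z2 = 1 by rewrite -normcM z12 normc1.
have := normc_ge0 z2; nra.
Qed.

(** The point of the closed unit disc that corresponds to [lam]. *)
Definition joukowski lam : R[i] :=
  xget 0 [set z | [/\ z != 0, normc z <= 1 & lam = z + z^-1]].

Lemma joukowskiP lam : [/\ joukowski lam != 0, normc (joukowski lam) <= 1 &
  lam = joukowski lam + (joukowski lam)^-1].
Proof. exact: (xgetPex 0 (joukowski_exists lam)). Qed.

Lemma dist_segment_le lam (t : R) : -2 <= t <= 2 ->
  dist_segment lam <= normc (lam - t%:C).
Proof.
move=> t2; apply: ge_inf; last by exists t => //=; rewrite in_itv.
by exists 0 => _ [u _ <-]; exact: normc_ge0.
Qed.

(** With [z = r * e], [normc e = 1], the point [e + e^-1] of the segment is close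
    enough to [z + z^-1]. *)
Lemma dist_segment_joukowski z : z != 0 -> normc z <= 1 ->
  dist_segment (z + z^-1) <= 2 * (1 - normc z) * (normc (1 - z ^+ 2) / normc z).
Proof.
move=> z0; rewrite -normc_gt0 in z0; set r := normc z in z0 * => r1.
pose e := z / r%:C; have rC0 : r%:C != 0 by rewrite fmorph_eq0 gt_eqF.
have ze : z = r%:C * e by rewrite /e mulrC divfK.
have e1 : normc e = 1 by rewrite /e normcM normcV normc_real gtr0_norm// divff// gt_eqF.
have ee : e * conjc e = 1 by rewrite mulc_conj e1 expr1n.
have e0 : e != 0 by rewrite -normc_eq0 e1 oner_eq0.
have eV : e^-1 = conjc e by rewrite -[RHS](mulKf e0) ee mulr1.
have te : (2 * complex.Re e)%:C = e + conjc e.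
  by case: (e) => x y; apply/eqP; rewrite eq_complex /=; apply/andP; split; apply/eqP; ring.
apply: le_trans (dist_segment_le _ (_ : -2 <= 2 * complex.Re e <= 2)) _.
  by have := Re_le_normc e; have := Re_geN_normc e; rewrite e1; lra.
have -> : z + z^-1 - (2 * complex.Re e)%:C = ((1 - r) / r)%:C * (conjc e * (1 - r%:C * e ^+ 2)).
  rewrite te -eV ze fmorph_div rmorphB rmorph1 /=; field.
  by rewrite rC0 e0.
rewrite normcM normc_real ger0_norm ?divr_ge0 ?subr_ge0 ?(ltW z0)//.
rewrite normcM normc_conj e1 mul1r.
have far : 1 - r ^+ 2 <= normc (1 - z ^+ 2).
  by apply: le_trans (normc_subD _ _); rewrite normc1 normcN normcX.
have : normc (1 - r%:C * e ^+ 2) <= 2 * normc (1 - z ^+ 2).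
  have -> : 1 - r%:C * e ^+ 2 = (1 - z ^+ 2) + - (r * (1 - r))%:C * e ^+ 2.
    by rewrite ze rmorphM rmorphB rmorph1 /=; ring.
  apply: le_trans (le_normcD _ _) _.
  rewrite normcM normcN normc_real normcX e1 expr1n mulr1 ger0_norm; last first.
    by rewrite mulr_ge0 ?subr_ge0// ltW.
  by nra.
set q := normc (1 - r%:C * _) => qle.
have -> : 2 * (1 - r) * (normc (1 - z ^+ 2) / r) = (1 - r) / r * (2 * normc (1 - z ^+ 2)).
  by ring.
by rewrite ler_wpM2l// divr_ge0 ?subr_ge0// ltW.
Qed.

(** The points with [normc z = 1] correspond to the segment, where the distance
    is zero. *)
Lemma weight_joukowski (eps : R) lam (z := joukowski lam) : 0 < eps < 1 ->
  dist_segment lam / normc (lam ^+ 2 - 4) `^ ((1 - eps) / 2)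
    <= if normc z < 1 then 2 * zero_weight eps z else 0.
Proof.
move=> /andP[eps0 eps1]; have [z0 z_le1 lamE] := joukowskiP lam; rewrite -/z in z0 z_le1 lamE.
have d_le := dist_segment_joukowski z0 z_le1; rewrite -lamE in d_le.
have r0 : 0 < normc z by rewrite normc_gt0.
have pV x : 0 <= (normc x `^ ((1 - eps) / 2))^-1 by rewrite invr_ge0 powR_ge0.
case: ltP => z1; last first.
  have zE : normc z = 1 by apply/eqP; rewrite eq_le z1 z_le1.
  rewrite zE subrr mulr0 mul0r in d_le.
  by rewrite mulr_le0_ge0.
set x := normc (1 - z ^+ 2) / normc z in d_le.
have x0 : 0 < x.
  rewrite divr_gt0// normc_gt0 subr_eq0 eq_sym; apply/negP => /eqP zE.
  have : normc (z ^+ 2) < 1 by rewrite normcX expr_lt1// ltW.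
  by rewrite zE normc1 ltxx.
have -> : normc (lam ^+ 2 - 4) = x ^+ 2.
  have -> : lam ^+ 2 - 4 = (- ((1 - z ^+ 2) / z)) ^+ 2 by rewrite lamE; field.
  by rewrite normcX normcN normcM normcV.
rewrite powR_exprn ?(ltW x0)// expr2 -powRD; last by rewrite (gt_eqF x0) implybT.
have -> : (1 - eps) / 2 + (1 - eps) / 2 = 1 - eps by field.
rewrite ler_pdivrMr ?powR_gt0//; apply: le_trans d_le _.
rewrite /zero_weight -/x -!mulrA -powRD; last by rewrite (gt_eqF x0) implybT.
have -> : eps + (1 - eps) = 1 by ring.
by rewrite powRr1// ltW.
Qed.

Lemma eigenvalue_vanishing (J : jacobi R) lam (z := joukowski lam) :
  (forall eta : R, 0 < eta -> \forall n \near \oo, normc (superdiag J n) <= 1 + eta) ->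
  discrete_spectrum (jacobi_op J) lam -> normc z < 1 ->
  vanishing_mod (('X - z%:P) ^+ alg_mult (jacobi_op J) lam)
    (fun n => jost (diag J) (fun n => subdiag J n * superdiag J n) n.+1).
Proof.
move=> Jc [_ _ mlam] z1; have [z0 _ lamE] := joukowskiP lam.
have : has_dim (root_space (jacobi_op J) lam) (alg_mult (jacobi_op J) lam).
  exact: (xgetPex 0%N mlam).
case: (alg_mult _ _) => [_|m].
  exists (fun=> 0) => [d d0|n]; last by rewrite expr0 dvd1p.
  by near=> n => x x1; rewrite horner0 normc0 ltW.
rewrite {1}lamE -/z => /root_space_chain[y yN y0].
exact: (jost_vanishing z0 yN z1 Jc y0).
Unshelve. all: by end_near. Qed.

Lemma root_prod_flatten (mz : seq (nat * R[i])) :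
  root_prod (flatten [seq nseq e.1 e.2 | e <- mz])
  = \prod_(e <- mz) ('X - e.2%:P) ^+ e.1.
Proof.
rewrite /root_prod big_flatten big_map; apply: eq_bigr => e _.
by rewrite big_nseq iter_mulr_1.
Qed.

Lemma vanishing_zeros_with_growth (b w : nat -> R[i]) (S : R) s :
  (forall n, \sum_(0 <= k < n) coef_dist b w k <= S) ->
  vanishing_mod (root_prod s) (fun n => jost b w n.+1) ->
  zeros_with_growth (2 * S) s.
Proof.
move=> wS [H V WH] d d0; have [n Hn] := filter_ex (V d d0).
have /dvdpP[g gE] := WH n; exists g => [x x1 xn1|].
  rewrite mulrC -gE hornerD hornerN; apply: le_trans (le_normcD _ _) _.
  rewrite normcN lerD ?Hn//; apply: le_trans (jost_growth b w n.+1 x1 xn1) _.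
  rewrite ler_expR -!mulrA ler_wpM2l// ler_wpM2r//.
  by rewrite divr_ge0 ?normc_ge0.
rewrite mulrC -gE hornerD hornerN jost_at0.
apply: le_trans (normc_subD _ _); rewrite normc1 normcN lerD2l lerN2.
by apply: Hn; rewrite normc0.
Qed.

Lemma sum_over_eigenvalues (eps : R) (J : jacobi R) (S : R) (s : seq R[i]) :
  0 < eps < 1 ->
  (forall eta : R, 0 < eta -> \forall n \near \oo, normc (superdiag J n) <= 1 + eta) ->
  (forall n, \sum_(0 <= k < n)
     coef_dist (diag J) (fun n => subdiag J n * superdiag J n) k <= S) ->
  uniq s -> (forall lam, lam \in s -> discrete_spectrum (jacobi_op J) lam) ->
  \sum_(lam <- s) (alg_mult (jacobi_op J) lam)%:R *
     (dist_segment lam / normc (lam ^+ 2 - 4) `^ ((1 - eps) / 2))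
  <= 2 * (zero_weight_constant eps * (2 * S)).
Proof.
move=> e01 Jc JS us sd.
pose s1 := [seq lam <- s | normc (joukowski lam) < 1].
pose mz := [seq (alg_mult (jacobi_op J) lam, joukowski lam) | lam <- s1].
pose zs := flatten [seq nseq e.1 e.2 | e <- mz].
have S0 : 0 <= S by have := JS 0%N; rewrite big_geq.
have zsK : zeros_with_growth (2 * S) zs.
  apply: vanishing_zeros_with_growth JS _; rewrite root_prod_flatten.
  apply: vanishing_mod_points.
    rewrite -map_comp map_inj_uniq ?filter_uniq// => l1 l2 /= l12.
    have [_ _ ->] := joukowskiP l1; have [_ _ ->] := joukowskiP l2.
    by rewrite l12.
  move=> e /mapP[lam]; rewrite mem_filter => /andP[lam1 lams] ->.
  exact: eigenvalue_vanishing (sd _ lams) lam1.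
have zs1 z : z \in zs -> 0 < normc z < 1.
  move=> /flatten_mapP[e /mapP[lam]]; rewrite mem_filter => /andP[lam1 _] -> /=.
  rewrite mem_nseq => /andP[_ /eqP ->]; rewrite lam1 andbT normc_gt0.
  by have [] := joukowskiP lam.
have S2 : 0 <= 2 * S by rewrite mulr_ge0.
have zsE : \sum_(z <- zs) zero_weight eps z =
   \sum_(lam <- s1) (alg_mult (jacobi_op J) lam)%:R * zero_weight eps (joukowski lam).
  rewrite /zs /mz big_flatten !big_map; apply: eq_bigr => lam _.
  by rewrite big_nseq iter_addr_0 mulr_natl.
apply: (@le_trans _ _ (2 * \sum_(z <- zs) zero_weight eps z)); last first.
  by rewrite ler_wpM2l// sum_zero_weight.
rewrite zsE mulr_sumr big_filter [leRHS]big_mkcond /=; apply: ler_sum => lam _.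
apply: (@le_trans _ _ ((alg_mult (jacobi_op J) lam)%:R *
   (if normc (joukowski lam) < 1 then 2 * zero_weight eps (joukowski lam) else 0))).
  by rewrite ler_wpM2l// weight_joukowski.
by case: ifP => _; rewrite ?mulr0// mulrCA.
Qed.

End Eigenvalues.

Theorem theorem0p1 (R : realType) (eps : R) (eps_gt0 : 0 < eps) (eps_lt1 : eps < 1) :
  exists2 C : R, 0 < C &
    forall J : jacobi R,
      trace_class (jacobi_op J \- jacobi_op laplacian) ->
      (eigenvalue_sum eps J <= C%:E * Delta J)%E.
Proof.
have e01 : 0 < eps < 1 by rewrite eps_gt0.
pose B := zero_weight_constant eps.
have B0 : 0 < B by exact: zero_weight_constant_gt0.
exists (4 * B) => [|J trJ]; first by rewrite mulr_gt0.
pose w n := subdiag J n * superdiag J n.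
have c0 k : (0 <= (normc (diag J k) + normc (1 - w k))%:E)%E.
  by rewrite lee_fin addr_ge0 ?normc_ge0.
have [Dfin|] := boolP (Delta J \is a fin_num); last first.
  rewrite ge0_fin_numE ?nneseries_ge0// -leNgt leye_eq => /eqP ->.
  by rewrite gt0_muley ?leey// lte_fin mulr_gt0.
pose S := fine (Delta J).
have JS n : \sum_(0 <= k < n) coef_dist (diag J) w k <= S.
  by rewrite -lee_fin fineK// -sumEFin; apply: nneseries_lim_ge => k _ _; exact: c0.
apply: ub_ereal_sup => _ [A [finA Asd] <-].
rewrite fsbig_finite//= sumEFin -[Delta J]fineK// -EFinM lee_fin.
have -> : 4 * B * S = 2 * (B * (2 * S)) by ring.
apply: sum_over_eigenvalues => //.
- exact: trace_class_superdiag.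
- exact: finmap.fset_uniq.
- by move=> lam; rewrite in_fset_set// inE => /Asd.
Qed.
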